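(* Let $G_1=\langle S_1\rangle$ and $G_2=\langle S_2\rangle$ be two finitely generated groups, with $S_1,S_2$ finite generating sets, and consider Bernoulli bond percolation on the Cayley graph of $G_1*G_2$ with respect to $S_1\cup S_2$, with critical probability $p_c$. For $i=1,2$ let $\chi_i(p)=\mathrm{E}_p(|C|_{G_i})$ denote the expected size of the cluster containing the origin in the Cayley graph of $G_i$ with respect to $S_i$. Then for every $0\le p<p_c$, the mean size of the cluster of the origin in the Cayley graph of $G_1*G_2$ satisfies $$\mathrm{E}_p(|C|_{G_1*G_2})=\frac{\chi_1(p)\chi_2(p)}{\chi_1(p)+\chi_2(p)-\chi_1(p)\chi_2(p)}.$$
   Context: Cayley graph: for a group $G$ with finite generating set $S$, the graph has vertex set $G$, and $g,h$ are adjacent iff $g^{-1}h\in S$ or $h^{-1}g\in S$, with the appropriate multiplicity (one edge joining $g$ and $gs$ for each pair $(g,s)\in G\times S$). The origin $o$ is the identity element. Bernoulli bond percolation with parameter $p\in[0,1]$ on a graph: each edge is independently open with probability $p$ and closed otherwise; $\mathrm{P}_p$ is the resulting product probability measure and $\mathrm{E}_p$ its expectation. A cluster is a connected component of the random subgraph (on all vertices) of open edges; $C$ is the cluster containing $o$, and $|C|$ is its number of vertices (written $|C|_G$ when the graph is the Cayley graph of $G$). The percolation function is $\theta(p)=\mathrm{P}_p(|C|=\infty)$ and the critical probability is $p_c=\inf\{p\in[0,1]:\theta(p)>0\}$, with $p_c=1$ for a finite graph. *)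

(* Defs.v *)
From HB Require Import structures.
From mathcomp Require Import all_boot all_order all_algebra finmap.
From mathcomp Require Import all_classical all_reals all_analysis.
From mathcomp Require Import ring.

Set Implicit Arguments.
Unset Strict Implicit.
Unset Printing Implicit Defensive.

Import Order.TTheory GRing.Theory Num.Theory.

Section FreeProduct.
Local Open Scope group_scope.
Variables G1 G2 : groupType.
Implicit Types (x y z : G1 + G2) (u v w : seq (G1 + G2)).

Definition trivial_letter x :=
  match x with inl g => g == 1 | inr h => h == 1 end.

Definition same_factor x y :=
  match x, y with
  | inl _, inl _ | inr _, inr _ => true
  | _, _ => false
  end.

Definition reduced w :=
  all (predC trivial_letter) w && sorted (fun x y => ~~ same_factor x y) w.

(* The normal form of the product of the letter x and the reduced word w. *)
Definition cons_letter x w :=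
  if trivial_letter x then w else
  match x, w with
  | inl g, inl h :: w' => if g * h == 1 then w' else inl (g * h) :: w'
  | inr g, inr h :: w' => if g * h == 1 then w' else inr (g * h) :: w'
  | _, _ => x :: w
  end.

Definition mul_word v w := foldr cons_letter w v.

Definition inv_letter x :=
  match x with inl g => inl g^-1 | inr h => inr h^-1 end.

Definition inv_word w := rev (map inv_letter w).

Lemma reduced_behead x w : reduced (x :: w) -> reduced w.
Proof.
by move=> /andP[/= /andP[_ aw] /path_sorted sw]; apply/andP.
Qed.

Lemma reduced_cons x w : reduced w -> reduced (cons_letter x w).
Proof.
rewrite /cons_letter; case: ifPn => // x1 rw.
suff cons_rw z t : ~~ trivial_letter z -> reduced t ->
    (if t is y :: _ then ~~ same_factor z y else true) -> reduced (z :: t).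
  case: x x1 => g g1; case: w rw => [|[h|h] w] rw; try exact: cons_rw.
    case: ifPn => gh; first exact: reduced_behead rw.
    apply: cons_rw (reduced_behead rw) _ => //.
    by move: rw => /andP[_ /=]; case: w => //= y w /andP[].
  case: ifPn => gh; first exact: reduced_behead rw.
  apply: cons_rw (reduced_behead rw) _ => //.
  by move: rw => /andP[_ /=]; case: w => //= y w /andP[].
move=> z1 /andP[at_ st] zt; rewrite /reduced /= z1 at_ /=.
by case: t zt st {at_} => //= y t -> ->.
Qed.

Lemma reduced_mul v w : reduced w -> reduced (mul_word v w).
Proof. by move=> rw; elim: v => //= x v; exact: reduced_cons. Qed.

Lemma reduced_inv w : reduced w -> reduced (inv_word w).
Proof.
move=> /andP[aw sw]; rewrite /reduced /inv_word all_rev rev_sorted.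
apply/andP; split.
  rewrite all_map; apply: sub_all aw => -[g|g] /=;
  by apply: contra => /eqP g1; rewrite -[g]invgK g1 invg1.
rewrite sorted_map; apply: sub_sorted sw.
by move=> [g|g] [h|h].
Qed.

Lemma cons_letter_reduced x w : reduced (x :: w) -> cons_letter x w = x :: w.
Proof.
move=> /andP[/= /andP[/negbTE nx _]]; rewrite /cons_letter nx.
by case: x w nx => g [|[h|h] w].
Qed.

Lemma cons_inlM g h w : reduced w ->
  cons_letter (inl g) (cons_letter (inl h) w) = cons_letter (inl (g * h)) w.
Proof.
rewrite /cons_letter /= => rw.
have [->|g1] := eqVneq g 1; first by rewrite mul1g.
have [->|h1] := eqVneq h 1; first by rewrite mulg1 (negbTE g1).
case: w rw => [|[k|k] w] rw.
- by case: ifP.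
- have [hk|hk] := eqVneq (h * k) 1.
    have -> : g * h == 1 = (g * h * k == k).
      by apply/eqP/eqP => [->|/(canRL (mulgK k))]; rewrite ?mul1g ?mulgV.
    rewrite -mulgA hk mulg1; have [<-|gk] := eqVneq g k.
      by case: w rw => [|[l|l] w] //; rewrite /reduced /= andbF.
    by case: w rw => [|[l|l] w]; rewrite ?(negbTE g1) // /reduced /= andbF.
  rewrite mulgA; have [gh|gh] := eqVneq (g * h) 1.
    rewrite gh mul1g; case: ifP => // /eqP k1.
    by move: rw; rewrite /reduced /= k1 eqxx.
  by [].
- by case: ifP.
Qed.

Lemma cons_inrM g h w : reduced w ->
  cons_letter (inr g) (cons_letter (inr h) w) = cons_letter (inr (g * h)) w.
Proof.
rewrite /cons_letter /= => rw.
have [->|g1] := eqVneq g 1; first by rewrite mul1g.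
have [->|h1] := eqVneq h 1; first by rewrite mulg1 (negbTE g1).
case: w rw => [|[k|k] w] rw.
- by case: ifP.
- by case: ifP.
- have [hk|hk] := eqVneq (h * k) 1.
    have -> : g * h == 1 = (g * h * k == k).
      by apply/eqP/eqP => [->|/(canRL (mulgK k))]; rewrite ?mul1g ?mulgV.
    rewrite -mulgA hk mulg1; have [<-|gk] := eqVneq g k.
      by case: w rw => [|[l|l] w] //; rewrite /reduced /= andbF.
    by case: w rw => [|[l|l] w]; rewrite ?(negbTE g1) // /reduced /= andbF.
  rewrite mulgA; have [gh|gh] := eqVneq (g * h) 1.
    rewrite gh mul1g; case: ifP => // /eqP k1.
    by move: rw; rewrite /reduced /= k1 eqxx.
  by [].
Qed.

Lemma mul_word_cons x v w : reduced w ->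
  mul_word (cons_letter x v) w = cons_letter x (mul_word v w).
Proof.
move=> rw; rewrite {1}/cons_letter; case: ifP => [x1|nx].
  by rewrite /cons_letter x1.
case: x nx => g g1; case: v => [|[h|h] v] //=.
  rewrite cons_inlM ?reduced_mul //; case: ifP => // gh.
  by rewrite /cons_letter /= gh.
rewrite cons_inrM ?reduced_mul //; case: ifP => // gh.
by rewrite /cons_letter /= gh.
Qed.

(* The free product is the group of normal forms: words in nontrivial letters
   taken alternately from the two factors. *)
Record free_product := FreeProduct {
  word_of : seq (G1 + G2);
  word_ofP : reduced word_of }.

HB.instance Definition _ := [isSub for word_of].
HB.instance Definition _ := [Choice of free_product by <:].

Implicit Types a b c : free_product.

Definition free_one := @FreeProduct [::] isT.
Definition free_mul a b := FreeProduct (reduced_mul (word_of a) (word_ofP b)).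
Definition free_inv a := FreeProduct (reduced_inv (word_ofP a)).

Lemma free_mulA : associative free_mul.
Proof.
move=> a b c; apply: val_inj => /=.
elim: (word_of a) => //= x v ->.
by rewrite mul_word_cons ?word_ofP.
Qed.

Lemma free_mul1g : left_id free_one free_mul.
Proof. by move=> a; apply: val_inj. Qed.

Lemma free_mulg1 : right_id free_one free_mul.
Proof.
case=> w rw; apply: val_inj => /=; rewrite /mul_word.
elim: w rw => //= x w ih rw.
by rewrite ih ?(reduced_behead rw) // cons_letter_reduced.
Qed.

Lemma free_mulVg : left_inverse free_one free_inv free_mul.
Proof.
case=> w rw; apply: val_inj => /=; rewrite /mul_word /inv_word.
elim: w rw => //= x w ih rw.
rewrite rev_cons foldr_rcons.
suff -> : cons_letter (inv_letter x) (x :: w) = w.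
  exact: ih (reduced_behead rw).
move: rw => /andP[/= /andP[nx _] _]; rewrite /cons_letter.
have -> : trivial_letter (inv_letter x) = false.
  case: x nx => g /= /negbTE <-; apply/eqP/eqP => [g1|->]; rewrite ?invg1 //.
  - by rewrite -[g]invgK g1 invg1.
  - by rewrite -[g]invgK g1 invg1.
by case: x {nx} => g /=; rewrite mulVg eqxx.
Qed.

Lemma free_mulgV : right_inverse free_one free_inv free_mul.
Proof.
move=> a; have [b ba] : exists b, free_mul b (free_inv a) = free_one.
  by exists (free_inv (free_inv a)); rewrite free_mulVg.
by rewrite -[LHS]free_mul1g -{1}ba -free_mulA (free_mulA (free_inv a))
   free_mulVg free_mul1g.
Qed.

HB.instance Definition _ := isGroup.Build free_product
  free_mulA free_mul1g free_mulg1 free_mulVg free_mulgV.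

Definition word1 x : seq (G1 + G2) := if trivial_letter x then [::] else [:: x].

Lemma reduced_word1 x : reduced (word1 x).
Proof. by rewrite /word1; case: ifPn => // x1; rewrite /reduced /= x1. Qed.

Definition free_inl (g : G1) := FreeProduct (reduced_word1 (inl g)).
Definition free_inr (h : G2) := FreeProduct (reduced_word1 (inr h)).

Lemma free_inlM : {morph free_inl : g h / g * h}.
Proof.
move=> g h; apply: val_inj; rewrite /= /word1 /mul_word /=.
have [->|g1] := eqVneq g 1; first by rewrite mul1g.
have [->|h1] := eqVneq h 1; last by rewrite /= /cons_letter /= (negbTE g1).
by rewrite mulg1 (negbTE g1) /= /cons_letter /= (negbTE g1).
Qed.

Lemma free_inrM : {morph free_inr : g h / g * h}.
Proof.
move=> g h; apply: val_inj; rewrite /= /word1 /mul_word /=.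
have [->|g1] := eqVneq g 1; first by rewrite mul1g.
have [->|h1] := eqVneq h 1; last by rewrite /= /cons_letter /= (negbTE g1).
by rewrite mulg1 (negbTE g1) /= /cons_letter /= (negbTE g1).
Qed.

End FreeProduct.

Definition generates (G : groupType) (S : {fset G}) :=
  forall H : {pred G}, group_closed H -> {subset S <= H} -> forall g, g \in H.

Definition free_gens (G1 G2 : groupType) (S1 : {fset G1}) (S2 : {fset G2}) :
    {fset free_product G1 G2} :=
  ([fset free_inl G2 s | s in S1] `|` [fset free_inr G1 s | s in S2])%fset.

Local Open Scope classical_set_scope.
Local Open Scope ring_scope.

Section Cylinders.
Variable E : choiceType.
Implicit Types (s t : seq E) (A B : set (E -> bool)) (w : E -> bool).

Definition depends_on (T : Type) s (f : (E -> bool) -> T) :=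
  forall w w', {in s, w =1 w'} -> f w = f w'.

Definition cylinder : set_system (E -> bool) :=
  [set A | exists s, depends_on s A].

Lemma depends_onS (T : Type) s t (f : (E -> bool) -> T) :
  {subset s <= t} -> depends_on s f -> depends_on t f.
Proof. by move=> st sf w w' ww'; apply: sf => e /st; exact: ww'. Qed.

Lemma cylinder0 : cylinder set0.
Proof. by exists [::]. Qed.

Lemma cylinderC : setC_closed cylinder.
Proof. by move=> A [s sA]; exists s => w w' /sA; rewrite /setC /= => ->. Qed.

Lemma cylinderU : setU_closed cylinder.
Proof.
move=> A B [s sA] [t tB]; exists (s ++ t) => w w' ww'; rewrite /setU /=.
congr (_ \/ _); first by apply: sA => e es; rewrite ww' // mem_cat es.
by apply: tB => e et; rewrite ww' // mem_cat et orbT.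
Qed.

Definition cylinder_space := E -> bool.
HB.instance Definition _ := Pointed.copy cylinder_space (E -> bool).

Definition cylinder_display : measure_display.
Proof. exact: default_measure_display. Qed.

HB.instance Definition _ := @isAlgebraOfSets.Build cylinder_display
  cylinder_space cylinder cylinder0 cylinderU cylinderC.

End Cylinders.

Section ConfigTopology.
Variable E : choiceType.

Definition config_topology := prod_topology (fun _ : E => bool).
HB.instance Definition _ := Topological.on config_topology.
HB.instance Definition _ := Pointed.copy config_topology (E -> bool).

Lemma cylinder_open (A : set config_topology) : cylinder A -> open A.
Proof.
move=> [s sA]; rewrite openE => w Aw.
have : \forall w' \near w, {in s, w =1 w'}.
  elim: s {sA} => [|e s ih]; first by apply: filterE => w' x; rewrite in_nil.
  have : \forall w' \near w, w' e = w e.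
    have := @proj_continuous E (fun=> bool) e w [set w e].
    by apply; apply: discrete_set1.
  move=> he; apply: filterS2 he ih => w' we ws x; rewrite inE.
  by move=> /orP[/eqP->|/ws].
by apply: filterS => w' /sA; rewrite /interior => <-.
Qed.

Lemma cylinder_compact (A : set config_topology) : cylinder A -> compact A.
Proof.
move=> cA; apply: (@subclosed_compact _ _ setT) => //.
  by rewrite -openC; apply: cylinder_open; exact: cylinderC.
have := @tychonoff E (fun=> bool) (fun=> setT) (fun=> bool_compact).
by congr (compact _); rewrite eqEsubset.
Qed.

End ConfigTopology.

(* The cylinders generate the product sigma-algebra. *)
Definition config (E : choiceType) :=
  g_sigma_algebraType (@measurable _ (cylinder_space E)).

Section CylinderMeasure.
Variables (R : realType) (E : choiceType) (p : {i01 R}).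
Implicit Types (s t : seq E) (w : E -> bool) (e : E).
Implicit Types (f g : (E -> bool) -> R).

Definition set_edge e (b : bool) w : E -> bool :=
  fun e' => if e' == e then b else w e'.

(* Expectation over the state of the single edge e *)
Definition average e f w : R :=
  p%:num * f (set_edge e true w) + (1 - p%:num) * f (set_edge e false w).

Definition averages s f := foldr average f s.

Let p0 : 0 <= p%:num. Proof. by []. Qed.
Let q0 : 0 <= 1 - p%:num. Proof. by rewrite subr_ge0. Qed.

Lemma averageC e e' f : average e (average e' f) = average e' (average e f).
Proof.
have [->//|ne] := eqVneq e e'; apply/funext => w; rewrite /average.
have C b b' : set_edge e' b (set_edge e b' w) = set_edge e b' (set_edge e' b w).
  apply/funext => x; rewrite /set_edge.
  by have [->|//] := eqVneq x e'; rewrite eq_sym (negbTE ne).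
by rewrite !C; ring.
Qed.

Lemma averagesC s t f : averages s (averages t f) = averages t (averages s f).
Proof.
have C e u g : average e (averages u g) = averages u (average e g).
  by elim: u => //= e' u ih; rewrite averageC ih.
by elim: s => //= e s ->; rewrite C.
Qed.

Lemma average_dep e s f :
  depends_on (e :: s) f -> depends_on s (average e f).
Proof.
move=> sf w w' ww'; rewrite /average.
by congr (_ * _ + _ * _); apply: sf => x; rewrite inE /set_edge;
  case: eqP => //= _ /ww'.
Qed.

Lemma averages_dep s t f : depends_on (s ++ t) f -> depends_on t (averages s f).
Proof.
elim: s t f => //= e s ih t f sf; apply/average_dep/ih.
by apply: depends_onS sf => x; rewrite !(inE, mem_cat) orbCA.
Qed.

Lemma averages_cst s f : depends_on [::] f -> averages s f = f.
Proof.
move=> cf; elim: s => //= e s ->; apply/funext => w.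
by rewrite /average !(cf _ w) //; ring.
Qed.

Lemma averages_eq s t f w : depends_on s f -> depends_on t f ->
  averages s f w = averages t f w.
Proof.
move=> sf tf; have Cs u : depends_on u f -> depends_on [::] (averages u f).
  by move=> uf; apply: averages_dep; rewrite cats0.
by rewrite -(averages_cst t (Cs _ sf)) averagesC averages_cst //; exact: Cs.
Qed.

Lemma averagesD s f g :
  averages s (fun w => f w + g w) = (fun w => averages s f w + averages s g w).
Proof.
by elim: s => //= e s ->; apply/funext => w; rewrite /average; ring.
Qed.

Lemma averagesMl s g f :
  (forall e, e \in s -> forall b w, g (set_edge e b w) = g w) ->
  averages s (fun w => g w * f w) = (fun w => g w * averages s f w).
Proof.
elim: s => //= e s ih gs; rewrite ih => [|x xs]; last first.
  by apply: gs; rewrite inE xs orbT.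
by apply/funext => w; rewrite /average !gs ?mem_head //; ring.
Qed.

Lemma le_averages s f g : (forall w, f w <= g w) ->
  forall w, averages s f w <= averages s g w.
Proof.
by move=> fg; elim: s => //= e s ih w; rewrite lerD // ler_wpM2l.
Qed.

Lemma averages1 s (c : R) : averages s (fun=> c) = fun=> c.
Proof. exact: averages_cst. Qed.

Definition cyl_support (A : set (E -> bool)) : seq E :=
  xget [::] [set s | depends_on s A].

Lemma cyl_supportP A : cylinder A -> depends_on (cyl_support A) A.
Proof. by move=> /(xgetPex [::]). Qed.

Lemma depends_indic s (A : set (E -> bool)) :
  depends_on s A -> depends_on s (\1_A : _ -> R).
Proof.
move=> sA w w' ww'; rewrite !indicE; congr (_%:R); congr nat_of_bool.
by apply/idP/idP; rewrite !inE (sA _ _ ww').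
Qed.

(* The value does not depend on the support nor on the configuration at which
   the (constant) average is evaluated, see cyl_measureE. *)
Definition cyl_measure (A : set (cylinder_space E)) : \bar R :=
  (averages (cyl_support A) \1_A xpred0)%:E.

Lemma cyl_measureE s A w : depends_on s A ->
  cyl_measure A = (averages s \1_A w)%:E.
Proof.
move=> sA; have cA : cylinder A by exists s.
rewrite /cyl_measure (averages_eq _ (depends_indic (cyl_supportP cA))
  (depends_indic sA)); congr EFin.
have : depends_on [::] (averages s (\1_A : _ -> R)); last exact.
by apply: averages_dep; rewrite cats0; exact: depends_indic.
Qed.

Lemma cyl_measure_ge0 A : (0 <= cyl_measure A)%E.
Proof.
rewrite lee_fin -[leLHS]/((fun=> 0) (xpred0 : E -> bool)).
rewrite -(averages1 (cyl_support A) 0).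
by apply: le_averages => w.
Qed.

Lemma cyl_measure0 : cyl_measure set0 = 0%E.
Proof.
rewrite (@cyl_measureE [::] _ xpred0) //=.
by rewrite indicE in_set0.
Qed.

Lemma cyl_measureU A B : measurable A -> measurable B -> A `&` B = set0 ->
  cyl_measure (A `|` B) = (cyl_measure A + cyl_measure B)%E.
Proof.
move=> [s sA] [t tB] AB.
have dA : depends_on (s ++ t) A.
  by apply: depends_onS sA => x; rewrite mem_cat => ->.
have dB : depends_on (s ++ t) B.
  by apply: depends_onS tB => x; rewrite mem_cat => ->; rewrite orbT.
have dAB : depends_on (s ++ t) (A `|` B).
  by move=> w w' ww'; rewrite /setU /= (dA _ _ ww') (dB _ _ ww').
rewrite !(@cyl_measureE (s ++ t) _ xpred0) // -EFinD; congr EFin.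
rewrite -[RHS]/((fun w => averages (s ++ t) \1_A w + averages (s ++ t) \1_B w)
   xpred0) -averagesD; congr (averages _ _ _); apply/funext => w.
rewrite !indicE in_setU; have [wA|//] := boolP (w \in A); last by rewrite add0r.
have [wB|] := boolP (w \in B); last by rewrite addr0.
by have : (A `&` B) w; [split; exact: set_mem|rewrite AB].
Qed.

Lemma cyl_measure_semi_additive : measure_function.semi_additive cyl_measure.
Proof.
apply/(additive2P cyl_measure0) => A B mA mB.
exact: cyl_measureU.
Qed.

HB.instance Definition _ := isContent.Build _ (cylinder_space E) R
  cyl_measure cyl_measure_ge0 cyl_measure_semi_additive.

Lemma cyl_measure_sigma_subadditive :
  measurable_subset_sigma_subadditive cyl_measure.
Proof.
move=> A F mF mA AF.
have := cylinder_compact mA.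
rewrite compact_cover => /(_ nat setT F) [n _||D _ AD].
- exact/cylinder_open/mF.
- by move=> w /AF.
pose N := (\max_(i <- D) i).+1.
apply: (@le_trans _ _ (\sum_(k < N) cyl_measure (F k))%E).
  apply: content_subadditive => // w /AD[i iD Fi].
  rewrite -bigcup_mkord; exists i => //=; rewrite ltnS.
  exact: leq_bigmax_seq.
by rewrite -(big_mkord xpredT (cyl_measure \o F)); apply: nneseries_lim_ge.
Qed.

HB.instance Definition _ := Content_SigmaSubAdditive_isMeasure.Build _ R
  (cylinder_space E) cyl_measure cyl_measure_sigma_subadditive.

Definition bernoulli_percolation : set (config E) -> \bar R :=
  measure_extension cyl_measure.

HB.instance Definition _ := Measure.on bernoulli_percolation.

Lemma bernoulli_percolation_setT : bernoulli_percolation setT = 1%E.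
Proof.
transitivity (cyl_measure setT).
  by rewrite /bernoulli_percolation /measure_extension measurable_mu_extE.
by rewrite (@cyl_measureE [::] _ xpred0) //= indicE in_setT.
Qed.

HB.instance Definition _ := Measure_isProbability.Build _ _ R
  bernoulli_percolation bernoulli_percolation_setT.

(* By uniqueness of extensions, this characterizes the product measure. *)
Lemma bernoulli_percolation_cylinder (s : seq E) (a : E -> bool) : uniq s ->
  bernoulli_percolation [set w : config E | {in s, w =1 a}] =
  (\prod_(e <- s) if a e then p%:num else 1 - p%:num)%:E.
Proof.
move=> us; set A := (X in bernoulli_percolation X).
have dA : depends_on s (A : set (E -> bool)).
  move=> w w' ww'; apply/propext.
  by split=> h e es; rewrite -h // ww'.
transitivity (cyl_measure A).
  rewrite /bernoulli_percolation /measure_extension measurable_mu_extE //.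
  by exists s.
rewrite (cyl_measureE a dA) {dA}; congr EFin.
have {A} -> : (\1_A : (E -> bool) -> R) =
    fun w => (all (fun e => w e == a e) s)%:R.
  apply/funext => w; rewrite indicE; congr (nat_of_bool _)%:R.
  apply/idP/allP => [/set_mem h e /h /eqP //|h].
  by apply/mem_set => e /h/eqP.
suff -> : averages s (fun w => (all (fun e => w e == a e) s)%:R) =
    fun=> \prod_(e <- s) if a e then p%:num else 1 - p%:num by [].
elim: s us => [|e s ih] /=; first by rewrite big_nil.
move=> /andP[es us].
rewrite (_ : (fun w : E -> bool => _) = fun w : E -> bool =>
    (w e == a e)%:R * (all (fun e => w e == a e) s)%:R); last first.
  by apply/funext => w; rewrite -natrM mulnb.
rewrite averagesMl => [|x xs b w]; last first.
  by rewrite /set_edge; case: (e =P x) => // ex; rewrite ex xs in es.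
rewrite ih // big_cons; apply/funext => w.
by rewrite /average /set_edge eqxx; case: (a e) => /=; ring.
Qed.

End CylinderMeasure.

(* Parallel edges and loops are allowed. The orientation of an edge given by
   the order of its two ends plays no role in percolation. *)
Record multigraph := Multigraph {
  vertex : choiceType;
  edge : choiceType;
  ends : edge -> vertex * vertex }.

Definition cayley_graph (G : groupType) (S : {fset G}) : multigraph :=
  @Multigraph G (G * S)%type
    (fun gs => (gs.1, (gs.1 * val gs.2)%g)).

Section Percolation.
Variables (R : realType) (X : multigraph) (o : vertex X).
Implicit Types (w : config (edge X)) (p : {i01 R}).

Definition open_adjacent w : rel (vertex X) := fun x y =>
  `[< exists2 e, w e & ends e = (x, y) \/ ends e = (y, x) >].

Definition cluster w : set (vertex X) :=
  [set y | exists2 s, path (open_adjacent w) o s & last o s = y].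

Definition mean_cluster_size p : \bar R :=
  \int[bernoulli_percolation p]_w counting (cluster w).

Definition theta p : \bar R :=
  bernoulli_percolation p [set w | infinite_set (cluster w)].

(* For an infinite connected graph the set below contains 1, so that it is
   nonempty and its infimum is not a default value. *)
Definition critical_probability : R :=
  if `[< finite_set [set: vertex X] >] then 1
  else inf [set p%:num | p in [set p | (0 < theta p)%E]].

End Percolation.

(* Main.v *)
(* In the free product every vertex is uniquely z = g u with g in G1 and u a
   word that does not begin with a letter of G1.  The map z |-> g collapses all
   edges outside the copy of the Cayley graph of G1 through the origin, so an
   open path from 1 to g u exists iff there is one from 1 to g inside that copy
   and one from g to g u outside it; these events depend on disjoint sets of
   edges.  Summing over z gives chi = chi1 * A1, where A1 is the mean number of
   words u of this kind in the cluster of 1, and likewise chi = chi2 * A2.  A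
   nonempty word begins with a letter of exactly one factor, hence
   A1 + A2 = chi + 1, and the formula follows as soon as chi is finite.

   Finiteness below p_c is the sharpness of the phase transition, proved as by
   Duminil-Copin and Tassion: let flow_p(S) be the expected number of boundary
   edges of the finite set S whose inner end is joined to the origin in S.  If
   flow_p(S) < 1 for some S, cutting open paths at the cluster of the origin
   in S bounds chi by #|S| / (1 - flow_p(S)).  If flow_p(S) >= 1 for all S, then
   by Russo's formula the probability of leaving any finite set has derivative
   at least one minus itself, so that theta > 0 at every parameter above p. *)

Require Import Defs.
From HB Require Import structures.
From mathcomp Require Import all_boot all_order all_algebra finmap.
From mathcomp Require Import all_classical all_reals all_analysis.
From mathcomp Require Import ring lra.

Set Implicit Arguments.
Unset Strict Implicit.
Unset Printing Implicit Defensive.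

Import Order.TTheory GRing.Theory Num.Theory.
Local Open Scope ring_scope.
Local Open Scope classical_set_scope.

Local Notation cluster := Defs.cluster.

(** * Expectations in finite volume *)

Section Indicator.
Variables (R : realType) (T : Type).
Implicit Types (A B : set T).

Lemma le_indic (T' : Type) A (B : set T') (w : T) (w' : T') :
  (A w -> B w') -> (\1_A w : R) <= \1_B w'.
Proof.
move=> AB; rewrite !indicE ler_nat.
by have [/set_mem/AB/mem_set ->|//] := boolP (w \in A).
Qed.

Lemma eq_indic (T' : Type) A (B : set T') (w : T) (w' : T') :
  (A w <-> B w') -> (\1_A w : R) = \1_B w'.
Proof.
by move=> [AB BA]; rewrite !indicE; congr (nat_of_bool _)%:R;
apply/idP/idP => /set_mem ?; apply/mem_set; auto.
Qed.

Lemma indic1 A w : A w -> \1_A w = 1 :> R.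
Proof. by move=> Aw; rewrite indicE mem_set. Qed.

Lemma indic0 A w : ~ A w -> \1_A w = 0 :> R.
Proof. by move=> Aw; rewrite indicE memNset. Qed.

Lemma indic_le1 A w : \1_A w <= 1 :> R.
Proof. by rewrite indicE; case: (w \in A). Qed.

Lemma indicM A B w : \1_(A `&` B) w = \1_A w * \1_B w :> R.
Proof.
by rewrite !indicE in_setI; case: (w \in A); rewrite ?mul1r ?mul0r.
Qed.

End Indicator.

Section FiniteVolume.
Variables (R : realType) (E : choiceType) (p : {i01 R}).
Implicit Types (s t : seq E) (w : E -> bool) (e : E) (P : pred E).
Implicit Types (f g : (E -> bool) -> R) (A B : set (E -> bool)).

(** Unlike the list in [depends_on], the set of edges [P] may be infinite, so that independence can
    be stated for complementary sets of edges. *)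
Definition determined_by (T : Type) P (f : (E -> bool) -> T) :=
  forall w w', (forall e, P e -> w e = w' e) -> f w = f w'.

Definition increasing_event A :=
  forall w w', (forall e, w e -> w' e) -> A w -> A w'.

Definition restrict P w : E -> bool := fun e => P e && w e.

(* The edges outside s are closed. *)
Definition expect s f : R := averages p s f xpred0.

(* The measure of A when A is increasing and determined by finite sets of open
   edges, see bernoulli_increasing. *)
Definition prob A : R := sup [set expect s \1_A | s in setT].

Lemma averages_cat s t f :
  averages p (s ++ t) f = averages p s (averages p t f).
Proof. exact: foldr_cat. Qed.

(** Averaging over [s] evaluates the function only at configurations that agree with [w] off [s]. *)
Lemma averages_local s f g w :
    (forall w', (forall e, e \notin s -> w' e = w e) -> f w' = g w') ->
  averages p s f w = averages p s g w.
Proof.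
elim: s w => [|e s ih] w fg /=; first exact: fg.
rewrite /average; congr (_ * _ + _ * _); apply: ih => w' w'w; apply: fg => x;
by rewrite inE negb_or => /andP[xe xs]; rewrite w'w // /set_edge (negbTE xe).
Qed.

Lemma averages_determined P s f :
  determined_by P f -> determined_by P (averages p s f).
Proof.
move=> Pf; elim: s => //= e s ih w w' ww'.
rewrite /average; congr (_ * _ + _ * _); apply: ih => x Px;
by rewrite /set_edge; case: eqP => // _; exact: ww'.
Qed.

(** Independence: at each edge that is averaged, one of the two factors does not depend on the state
    of that edge. *)
Lemma averagesM P s f g : determined_by P f -> determined_by (predC P) g ->
  averages p s (fun w => f w * g w) =
  (fun w => averages p s f w * averages p s g w).
Proof.
move=> Pf Pg; elim: s => //= e s ->; apply/funext => w; rewrite /average.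
have fs := averages_determined s Pf; have gs := averages_determined s Pg.
have [Pe|Pe] := boolP (P e).
  have C b : averages p s g (set_edge e b w) = averages p s g w.
    apply: gs => x; rewrite /set_edge inE.
    by have [->|//] := eqVneq x e; rewrite Pe.
  by rewrite !C; ring.
have C b : averages p s f (set_edge e b w) = averages p s f w.
  apply: fs => x; rewrite /set_edge.
  by have [->|//] := eqVneq x e; rewrite (negbTE Pe).
by rewrite !C; ring.
Qed.

Lemma expectM P s f g : determined_by P f -> determined_by (predC P) g ->
  expect s (fun w => f w * g w) = expect s f * expect s g.
Proof. by move=> Pf Pg; rewrite /expect (averagesM s Pf Pg). Qed.

Lemma expectC s (c : R) : expect s (fun=> c) = c.
Proof. by rewrite /expect averages1. Qed.

Lemma expect_sum (I : Type) (r : seq I) (Q : pred I) s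
    (f : I -> (E -> bool) -> R) :
  expect s (fun w => \sum_(i <- r | Q i) f i w) =
  \sum_(i <- r | Q i) expect s (f i).
Proof.
elim: r => [|i r ih].
  rewrite big_nil -[RHS](expectC s); congr expect; apply/funext => w.
  by rewrite big_nil.
rewrite big_cons; under eq_fun do rewrite big_cons.
case: (Q i) => //; rewrite -ih /expect.
by rewrite (averagesD p s (f i)).
Qed.

Lemma le_expect s f g : (forall w, f w <= g w) -> expect s f <= expect s g.
Proof. by move=> fg; exact: le_averages. Qed.

Lemma expect_ge0 s f : (forall w, 0 <= f w) -> 0 <= expect s f.
Proof. by move=> f0; rewrite -(expectC s 0); exact: le_expect. Qed.

Lemma averages_homo s f w w' :
    (forall w w', (forall e, w e -> w' e) -> f w <= f w') ->
  (forall e, w e -> w' e) -> averages p s f w <= averages p s f w'.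
Proof.
move=> mf; elim: s w w' => [w w'|e s ih w w' ww'] /=; first exact: mf.
rewrite /average; apply: lerD; apply: ler_wpM2l; rewrite ?subr_ge0 //;
by apply: ih => x; rewrite /set_edge; case: eqP => // _; exact: ww'.
Qed.

(** In [expect s] the edges outside [s] are closed, so averaging over further edges can only open
    them. *)
Lemma expect_catr s t f : (forall w w', (forall e, w e -> w' e) -> f w <= f w') ->
  expect s f <= expect (s ++ t) f.
Proof.
move=> mf; rewrite /expect averages_cat averagesC.
rewrite -(expectC t (averages p s f xpred0)).
by apply: le_averages => w; exact: averages_homo.
Qed.

Lemma expect_catl s t f : (forall w w', (forall e, w e -> w' e) -> f w <= f w') ->
  expect s f <= expect (t ++ s) f.
Proof.
move=> mf; apply: le_trans (expect_catr s t mf) _.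
by rewrite /expect !averages_cat averagesC.
Qed.

Lemma expect_depends s t f : depends_on s f -> depends_on t f ->
  expect s f = expect t f.
Proof. by move=> sf tf; exact: averages_eq. Qed.

Lemma increasing_indic A w w' : increasing_event A -> (forall e, w e -> w' e) ->
  (\1_A w : R) <= \1_A w'.
Proof. by move=> iA ww'; apply: le_indic; exact: iA. Qed.

Lemma determined_indic P A : determined_by P A ->
  determined_by P (\1_A : _ -> R).
Proof. by move=> PA w w' /PA AA; apply: eq_indic; rewrite AA. Qed.

Lemma expect_indic_ge0 s A : 0 <= expect s \1_A.
Proof. exact: expect_ge0. Qed.

Lemma expect_indic_le1 s A : expect s \1_A <= 1.
Proof. by rewrite -(expectC s 1); apply: le_expect => w; exact: indic_le1. Qed.

Lemma has_sup_prob A : has_sup [set expect s \1_A | s in setT].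
Proof.
split; first by exists (expect [::] \1_A), [::].
by exists 1 => _ [s _ <-]; exact: expect_indic_le1.
Qed.

Lemma expect_le_prob s A : expect s \1_A <= prob A.
Proof. by apply: sup_upper_bound; [exact: has_sup_prob|exists s]. Qed.

Lemma prob_le A (c : R) : (forall s, expect s \1_A <= c) -> prob A <= c.
Proof.
move=> Ac; apply: ge_sup; first by case: (has_sup_prob A).
by move=> _ [s _ <-].
Qed.

Lemma prob_ge0 A : 0 <= prob A.
Proof. exact: le_trans (expect_indic_ge0 [::] A) (expect_le_prob _ _). Qed.

Lemma prob_le1 A : prob A <= 1.
Proof. by apply: prob_le => s; exact: expect_indic_le1. Qed.

Lemma prob_setT : prob setT = 1.
Proof.
apply/eqP; rewrite eq_le prob_le1 -{1}(expectC [::] 1).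
apply: le_trans (expect_le_prob [::] _); apply: le_expect => w.
by rewrite indic1.
Qed.

Lemma le_prob A B : A `<=` B -> prob A <= prob B.
Proof.
move=> AB; apply: prob_le => s; apply: le_trans (expect_le_prob s B).
by apply: le_expect => w; exact/le_indic/AB.
Qed.

Lemma prob_depends s A : increasing_event A -> depends_on s A ->
  prob A = expect s \1_A.
Proof.
move=> iA sA; apply/eqP; rewrite eq_le expect_le_prob andbT.
apply: prob_le => t; apply: le_trans (expect_catr t s _) _.
  by move=> w w'; exact: increasing_indic.
rewrite (@expect_depends (t ++ s) s) //; apply: depends_indic => //.
by apply: depends_onS sA => e; rewrite mem_cat orbC => ->.
Qed.

(** The product formula holds in each finite volume. To pass to the two suprema, finite volumes [s]
    for [A] and [t] for [B] are merged into [s ++ t], which decreases neither factor. *)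
Lemma prob_setI P A B : increasing_event A -> increasing_event B ->
  determined_by P A -> determined_by (predC P) B ->
  prob (A `&` B) = prob A * prob B.
Proof.
move=> iA iB PA PB.
have AB s : expect s \1_(A `&` B) = expect s \1_A * expect s \1_B.
  rewrite -(@expectM P) //; try exact: determined_indic.
  by congr expect; apply/funext => w; exact: indicM.
apply/eqP; rewrite eq_le; apply/andP; split.
  by apply: prob_le => s; rewrite AB ler_pM ?expect_le_prob ?expect_indic_ge0.
have E0 C s : 0 <= expect s \1_C by exact: expect_indic_ge0.
have AB' s t : expect s \1_A * expect t \1_B <= prob (A `&` B).
  apply: le_trans (expect_le_prob (s ++ t) _); rewrite AB.
  apply: ler_pM => //; [apply: expect_catr|apply: expect_catl] => w w';
  exact: increasing_indic.
(* The suprema are taken one at a time, after division by the other factor; a zero factor is treated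
   apart. *)
have sB s : expect s \1_A * prob B <= prob (A `&` B).
  have [->|n0] := eqVneq (expect s \1_A) 0; first by rewrite mul0r prob_ge0.
  have s0 : 0 < expect s \1_A by rewrite lt_neqAle eq_sym n0 E0.
  rewrite mulrC -ler_pdivlMr //; apply: prob_le => t.
  by rewrite ler_pdivlMr // mulrC.
have [->|n0] := eqVneq (prob B) 0; first by rewrite mulr0 prob_ge0.
have B0 : 0 < prob B by rewrite lt_neqAle eq_sym n0 prob_ge0.
by rewrite -ler_pdivlMr //; apply: prob_le => s; rewrite ler_pdivlMr.
Qed.

End FiniteVolume.

(** Reading a configuration along an injective map of edges preserves the product measure. This
    serves both for translations and for the copy of a factor inside the free product. *)
Lemma prob_pullback (R : realType) (p : {i01 R}) (E E' : choiceType)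
    (h : E -> E') (A : set (E -> bool)) : injective h ->
  prob p [set w : E' -> bool | A (w \o h)] = prob p A.
Proof.
move=> hI; have SE e b w : set_edge (h e) b w \o h = set_edge e b (w \o h).
  by apply/funext => x; rewrite /set_edge /= (inj_eq hI).
(* Edges outside the image of [h] do not affect [w \o h] and average out; the others are pulled back
   to form [t]. *)
have ex (f : (E -> bool) -> R) s :
    exists t, averages p s (fun w : E' -> bool => f (w \o h)) =
    fun w : E' -> bool => averages p t f (w \o h).
  elim: s => [|e s [t ih]] /=; first by exists [::].
  rewrite ih; have [[d <-]|ne] := pselect (exists d, h d = e).
    by exists (d :: t); apply/funext => w; rewrite /average !SE.
  exists t; apply/funext => w; rewrite /average.
  have C b : set_edge e b w \o h = w \o h.
    apply/funext => x; rewrite /set_edge /=; case: eqP => // hx.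
    by case: ne; exists x.
  by rewrite !C; ring.
have ex' (f : (E -> bool) -> R) s :
    averages p (map h s) (fun w : E' -> bool => f (w \o h)) =
    fun w : E' -> bool => averages p s f (w \o h).
  by elim: s => //= e s ->; apply/funext => w; rewrite /average !SE.
have AE : (\1_[set w : E' -> bool | A (w \o h)] : (E' -> bool) -> R) =
  fun w : E' -> bool => \1_A (w \o h) by apply/funext => w; exact: eq_indic.
apply/eqP; rewrite eq_le; apply/andP; split; apply: prob_le => s.
  have [t ht] := ex \1_A s.
  by rewrite AE /expect ht; exact: (expect_le_prob p t A).
apply: le_trans (expect_le_prob p (map h s) _).
by rewrite AE /expect ex' lexx.
Qed.

(** * The percolation measure on increasing events *)

(** Countability in the form used for limits. Repetitions in the lists are allowed and are removed
    by [undup] where sums are taken. *)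
Definition exhausting (T : eqType) (F : nat -> seq T) :=
  (forall m n, (m <= n)%N -> {subset F m <= F n}) /\
  (forall x, exists n, x \in F n).

Lemma exhausting_finite (T : eqType) (L : nat -> seq T) (s : seq T) :
  exhausting L -> exists n, {subset s <= L n}.
Proof.
move=> [Lm Lx]; elim: s => [|x s [n sn]]; first by exists 0%N.
have [m xm] := Lx x; exists (maxn m n) => y; rewrite inE => /predU1P[->|ys].
  by apply: Lm xm; exact: leq_maxl.
by apply: Lm (sn _ ys); exact: leq_maxr.
Qed.

(** For an increasing event this says that each occurrence is witnessed by finitely many open edges,
    which makes the event a countable union of cylinders along an exhaustion. *)
Definition finitary_event (E : choiceType) (A : set (E -> bool)) :=
  forall w, A w -> exists s : seq E, A (restrict (mem s) w).

Section InfiniteVolume.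
Variables (R : realType) (E : choiceType) (p : {i01 R}).
Implicit Types (s t : seq E) (A B : set (E -> bool)).

Let P : set (config E) -> \bar R := bernoulli_percolation p.

Lemma cylinder_measurable s A : depends_on s A ->
  measurable (A : set (config E)).
Proof. by move=> sA; apply: sub_gen_smallest; exists s. Qed.

Lemma bernoulli_depends s A : depends_on s A -> P A = (expect p s \1_A)%:E.
Proof.
move=> sA; transitivity (cyl_measure p A).
  by rewrite /P /bernoulli_percolation /measure_extension measurable_mu_extE //;
    exists s.
exact: cyl_measureE.
Qed.

Lemma depends_restrict s A : depends_on s [set w | A (restrict (mem s) w)].
Proof.
move=> w w' ww' /=; congr A; apply/funext => e; rewrite /restrict /=.
by have [/ww' ->|] := boolP (e \in s).
Qed.

Lemma expect_restrict s (f : (E -> bool) -> R) :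
  expect p s (fun w => f (restrict (mem s) w)) = expect p s f.
Proof.
apply: averages_local => w ws; congr f; apply/funext => e; rewrite /restrict /=.
by have [|/ws] := boolP (e \in s).
Qed.

Section Exhaustion.
Variables (F : nat -> seq E) (exF : exhausting F).
Variables (A : set (E -> bool)) (iA : increasing_event A).
Hypothesis fA : finitary_event A.

Let A_ n : set (config E) := [set w | A (restrict (mem (F n)) w)].

Let A_E : A = \bigcup_n A_ n.
Proof.
rewrite eqEsubset; split => w.
  move=> /fA [s Aw]; have [n sn] := exhausting_finite s exF.
  exists n => //; apply: iA Aw => e; rewrite /restrict /= => /andP[/sn -> //].
by move=> [n _]; apply: iA => e; rewrite /restrict => /andP[].
Qed.

Let mA_ n : measurable (A_ n).
Proof. exact: (cylinder_measurable (@depends_restrict (F n) A)). Qed.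

Lemma increasing_measurable : measurable (A : set (config E)).
Proof. by rewrite A_E; apply: bigcup_measurable => n _. Qed.

(** The upper bound is continuity from below along [F]. The lower bound holds since closing the
    edges outside [s] shrinks an increasing event. *)
Lemma bernoulli_increasing : P A = (prob p A)%:E.
Proof.
have PA_ s : P [set w | A (restrict (mem s) w)] = (expect p s \1_A)%:E.
  rewrite (bernoulli_depends (@depends_restrict s A)).
  rewrite -(expect_restrict s \1_A).
  by congr EFin; congr expect; apply/funext => w; exact: eq_indic.
apply/eqP; rewrite eq_le; apply/andP; split.
  have ndA : {homo A_ : m n / (m <= n)%N >-> (m <= n)%O}.
    move=> m n mn; rewrite subsetEset => w; apply: iA => e.
    by rewrite /restrict /= => /andP[/(exF.1 _ _ mn) -> ].
  have mA : measurable (\bigcup_n A_ n) by rewrite -A_E; exact: increasing_measurable.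
  have c := nondecreasing_cvg_mu (mu := bernoulli_percolation p) mA_ mA ndA.
  rewrite {1}A_E -[P _](cvg_lim _ c) //; apply: lime_le.
    by apply/cvg_ex; eexists; exact: c.
  by apply: nearW => n /=; rewrite -/P PA_ lee_fin expect_le_prob.
have : P A \is a fin_num by exact: fin_num_measure increasing_measurable.
move=> /fineK <-; rewrite lee_fin; apply: prob_le => s.
rewrite -lee_fin fineK; last exact: fin_num_measure increasing_measurable.
rewrite -PA_; apply: le_measure; rewrite ?inE.
- exact: (cylinder_measurable (@depends_restrict s A)).
- exact: increasing_measurable.
- by move=> w; apply: iA => e; rewrite /restrict => /andP[].
Qed.

End Exhaustion.
End InfiniteVolume.

(** * Open connections as increasing finitary events *)

Section Connection.
Variable X : multigraph.
Implicit Types (w : config (edge X)) (e : edge X) (x y z a b : vertex X).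

Lemma cluster_refl x w : cluster x w x.
Proof. by exists [::]. Qed.

Lemma cluster_open x w e a b : w e -> ends e = (a, b) \/ ends e = (b, a) ->
  cluster x w a -> cluster x w b.
Proof.
move=> we eab [s ps sa]; exists (rcons s b); rewrite ?last_rcons //.
by rewrite rcons_path ps sa; apply/asboolP; exists e.
Qed.

(** Induction along an open path from [x]; the step may use that the current vertex lies in the
    cluster. *)
Lemma cluster_rect x w (Q : vertex X -> Prop) : Q x ->
    (forall e a b, cluster x w a -> w e ->
       ends e = (a, b) \/ ends e = (b, a) -> Q a -> Q b) ->
  forall y, cluster x w y -> Q y.
Proof.
move=> Qx IH y [s ps <-{y}]; elim/last_ind: s ps => //= s b ih.
rewrite rcons_path last_rcons => /andP[ps /asboolP[e we eab]].
by apply: IH we eab (ih ps); exists s.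
Qed.

Lemma cluster_trans y x z w : cluster x w y -> cluster y w z -> cluster x w z.
Proof.
move=> xy; apply: cluster_rect => // e a b _ we eab.
exact: cluster_open we eab.
Qed.

Lemma cluster_sym x y w : cluster x w y -> cluster y w x.
Proof.
move: y; apply: cluster_rect => [|e a b _ we eab]; first exact: cluster_refl.
apply: cluster_trans; apply: cluster_open we _ (cluster_refl _ _).
by case: eab; [right|left].
Qed.

Lemma le_cluster x y w w' : (forall e, w e -> w' e) ->
  cluster x w y -> cluster x w' y.
Proof.
move=> ww'; apply: cluster_rect => [|e a b _ we eab].
  exact: cluster_refl.
by apply: cluster_open eab; exact: ww'.
Qed.

Lemma cluster_increasing x y : increasing_event [set w | cluster x w y].
Proof. by move=> w w'; exact: le_cluster. Qed.

Lemma cluster_finitary x y : finitary_event [set w | cluster x w y].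
Proof.
move=> w; rewrite /mkset; move: y; apply: cluster_rect => [|e a b _ we eab [s sa]].
  by exists [::]; exact: cluster_refl.
exists (e :: s) => /=; apply: (cluster_open (e := e) _ eab).
  by rewrite /restrict /= mem_head.
apply: le_cluster sa => e'; rewrite /restrict /= inE => /andP[-> ->].
by rewrite orbT.
Qed.

Lemma cluster_restrictW P x y w : cluster x (restrict P w) y -> cluster x w y.
Proof. by apply: le_cluster => e /andP[]. Qed.

Lemma restrict_increasing P x y :
  increasing_event [set w | cluster x (restrict P w) y].
Proof.
move=> w w' ww'; apply: le_cluster => e /andP[Pe /ww'].
by rewrite /restrict Pe.
Qed.

Lemma restrict_determined P x y :
  determined_by P [set w | cluster x (restrict P w) y].
Proof.
move=> w w' ww' /=; suff -> : restrict P w = restrict P w' by [].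
by apply/funext => e; rewrite /restrict; have [/ww' ->|] := boolP (P e).
Qed.

End Connection.

Definition connect_prob (R : realType) (p : {i01 R}) (X : multigraph)
    (x y : vertex X) : R :=
  prob p [set w | cluster x w y].

Definition escape (X : multigraph) (o : vertex X) (L : seq (vertex X)) :
    set (edge X -> bool) :=
  [set w | exists2 y, y \notin L & cluster o w y].

(** * Infinite sums as limits of finite ones *)

Section Esum.
Variables (R : realType) (T : choiceType).
Local Open Scope ereal_scope.

Lemma lee_sum_uniq (a : T -> \bar R) (r s : seq T) : (forall x, 0 <= a x) ->
  uniq r -> uniq s -> {subset r <= s} ->
  \sum_(x <- r) a x <= \sum_(x <- s) a x.
Proof.
move=> a0 ur us rs; rewrite (fsbig_seq _ _ ur) (fsbig_seq _ _ us).
apply: lee_fsum_nneg_subset => // x.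
by rewrite !inE; exact: rs.
Qed.

Lemma esum_seq (a : T -> \bar R) (r : seq T) : (forall x, 0 <= a x) ->
  uniq r -> \sum_(x <- r) a x <= \esum_(x in setT) a x.
Proof.
move=> a0 ur; apply: esum_ge; exists [set` r]; first by split.
by rewrite -fsbig_seq.
Qed.

Lemma esum_le_seq (a : T -> \bar R) (c : \bar R) : (forall x, 0 <= a x) ->
  (forall r, uniq r -> \sum_(x <- r) a x <= c) -> \esum_(x in setT) a x <= c.
Proof.
move=> a0 ac; apply: ge_ereal_sup => _ [A [fA _] <-].
by rewrite fsbig_finite //; apply: ac; exact: fset_uniq.
Qed.

Lemma esum_exhausting (a : T -> \bar R) (L : nat -> seq T) :
  (forall x, 0 <= a x) -> exhausting L ->
  \sum_(x <- undup (L n)) a x @[n --> \oo] --> \esum_(x in setT) a x.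
Proof.
move=> a0 exL; set u := fun n => _.
have -> : \esum_(x in setT) a x = ereal_sup (range u).
  apply/eqP; rewrite eq_le; apply/andP; split.
    apply: esum_le_seq => // r ur; have [n rn] := exhausting_finite r exL.
    apply: (@le_trans _ _ (u n)); last by apply: ereal_sup_ubound; exists n.
    by apply: lee_sum_uniq => //; [exact: undup_uniq|move=> x; rewrite mem_undup => /rn].
  apply: ge_ereal_sup => _ [n _ <-]; apply: esum_seq => //; exact: undup_uniq.
apply: ereal_nondecreasing_cvgn => m n mn; apply: lee_sum_uniq; rewrite ?undup_uniq //.
by move=> x; rewrite !mem_undup; exact: exL.1.
Qed.

Lemma counting_esum (C : set T) :
  counting C = \esum_(x in setT) (\1_C x : R)%:E.
Proof.
have sumE r : \sum_(x <- r) (\1_C x : R)%:E = (count (mem C) r)%:R%:E.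
  elim: r => [|x r ih]; first by rewrite big_nil.
  by rewrite big_cons ih /= natrD EFinD indicE.
rewrite /counting; case: ifPn => [/asboolP fC|/asboolPn iC].
  apply/eqP; rewrite eq_le; apply/andP; split.
    apply: le_trans (esum_seq _ (fset_uniq (fset_set C))) => //.
    rewrite sumE lee_fin ler_nat -size_filter cardfE; apply: eq_leq.
    rewrite -cardfE; congr size; symmetry; apply/all_filterP/allP => x.
    by rewrite in_fset_set.
  apply: esum_le_seq => // r ur; rewrite sumE lee_fin ler_nat -size_filter.
  apply: uniq_leq_size; first exact: filter_uniq.
  by move=> x; rewrite mem_filter in_fset_set // => /andP[].
(* An infinite set contains finite subsets of every size, so the sum exceeds every [M]. *)
apply/esym/eqyP => M _; have [B BC BM] := infinite_set_fset (Num.truncn M).+1 iC.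
apply: le_trans (esum_seq _ (fset_uniq B)) => //.
rewrite sumE lee_fin; apply: le_trans (ltW (truncnS_gt M)) _; rewrite ler_nat.
apply: leq_trans BM _.
rewrite -size_filter; apply: eq_leq; congr size; symmetry.
by apply/all_filterP/allP => x /BC xC; exact: mem_set.
Qed.

End Esum.

(** * Mean cluster size and percolation function through connection and escape events *)

Section Clusters.
Variables (R : realType) (X : multigraph) (o : vertex X) (p : {i01 R}).
Variables (F : nat -> seq (edge X)) (exF : exhausting F).
Variables (L : nat -> seq (vertex X)) (exL : exhausting L).

Lemma connect_prob_ge0 x y : 0 <= connect_prob p (X := X) x y.
Proof. exact: prob_ge0. Qed.

Lemma connect_probxx x : connect_prob p (X := X) x x = 1.
Proof.
rewrite -[RHS](prob_setT (edge X) p); congr prob.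
by rewrite eqEsubset; split => // w _; exact: cluster_refl.
Qed.

(** The size of the cluster is the sum over [y] of the indicators of connection to [y]; monotone
    convergence along [L] exchanges this sum with the integral. *)
Lemma mean_cluster_sizeE :
  mean_cluster_size o p = (\esum_(y in setT) (connect_prob p o y)%:E)%E.
Proof.
have mA y : measurable ([set w | cluster o w y] : set (config (edge X))).
  apply: (increasing_measurable exF); first exact: cluster_increasing.
  exact: cluster_finitary.
have sE w : (@counting _ R (cluster o w) =
    limn (fun n => \sum_(y <- undup (L n)) (\1_[set w | cluster o w y] w)%:E))%E.
  rewrite counting_esum.
  transitivity (\esum_(y in setT) (\1_[set w | cluster o w y] w : R)%:E)%E.
    by apply: eq_esum => y _; congr EFin; exact: eq_indic.
  by apply/esym/cvg_lim => //; exact: esum_exhausting.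
rewrite /mean_cluster_size; under eq_integral do rewrite sE.
rewrite monotone_convergence //; first last.
- move=> w _ m n mn.
  apply: lee_sum_uniq; rewrite ?undup_uniq // => y.
  by rewrite !mem_undup; exact: exL.1.
- by move=> n w _; apply: sume_ge0.
- move=> n; apply: emeasurable_sum => y.
  by apply/measurable_realfun.measurable_EFinP; exact: measurable_realfun.measurable_indic.
apply: cvg_lim => //.
rewrite (_ : (fun n => _) =
    fun n => \sum_(y <- undup (L n)) (connect_prob p o y)%:E)%E.
  by apply: esum_exhausting => // y; rewrite lee_fin connect_prob_ge0.
apply/funext => n; rewrite ge0_integral_sum //; last first.
  by move=> y; apply/measurable_realfun.measurable_EFinP; exact: measurable_realfun.measurable_indic.
apply: eq_bigr => y _; rewrite integral_indic // setIT.
apply: (bernoulli_increasing _ exF); first exact: cluster_increasing.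
exact: cluster_finitary.
Qed.

Lemma escape_increasing s : increasing_event (escape o s).
Proof. by move=> w w' ww' [y yL /(le_cluster ww')]; exists y. Qed.

Lemma escape_finitary s : finitary_event (escape o s).
Proof.
by move=> w [y yL /cluster_finitary [t ot]]; exists t; exists y.
Qed.

(** The cluster is infinite exactly when it leaves every [L n], because a finite one is contained in
    some [L n]. These events decrease, and continuity from above preserves the lower bound. *)
Lemma theta_escape (c : R) : 0 < c -> (forall n, c <= prob p (escape o (L n))) ->
  (0 < theta o p)%E.
Proof.
move=> c0 cL; have mB n : measurable (escape o (L n) : set (config (edge X))).
  apply: (increasing_measurable exF); first exact: escape_increasing.
  exact: escape_finitary.
have BE : [set w | infinite_set (cluster o w)] =
    \bigcap_n (escape o (L n) : set (config (edge X))).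
  rewrite eqEsubset; split => w /=.
    move=> iC n _; apply: contrapT => oL; apply: iC.
    apply: (sub_finite_set _ (finite_seq (L n))) => y oy.
    by apply: contrapT => /negP yL; apply: oL; exists y.
  move=> wL fC; have [n Cn] := exhausting_finite (fset_set (cluster o w)) exL.
  have [y yn oy] := wL n I; move/negP: yn; apply; apply: Cn.
  by rewrite in_fset_set //; exact: mem_set.
have mI : measurable (\bigcap_n (escape o (L n) : set (config (edge X)))).
  exact: bigcap_measurable.
have lt0 : (bernoulli_percolation p (escape o (L 0%N)) < +oo)%E.
  by rewrite ltey_eq fin_num_measure.
have ndB : {homo (fun n => escape o (L n) : set (config (edge X))) :
    m n / (m <= n)%N >-> (n <= m)%O}.
  move=> m n mn; rewrite subsetEset => w [y yn oy]; exists y => //.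
  by apply: contra yn; exact: exL.1.
have cv := nonincreasing_cvg_mu (mu := bernoulli_percolation p) lt0 mB mI ndB.
rewrite /theta BE; apply: (@lt_le_trans _ _ c%:E); first by rewrite lte_fin.
rewrite -(cvg_lim _ cv) //; apply: lime_ge.
  by apply/cvg_ex; eexists; exact: cv.
apply: nearW => n /=; rewrite (bernoulli_increasing _ exF) ?lee_fin //.
  exact: escape_increasing.
exact: escape_finitary.
Qed.

End Clusters.

(** * Sharpness of the phase transition *)

Section Russo.
Variables (R : realType) (E : choiceType).
Implicit Types (q : R) (s : seq E) (e : E) (w : E -> bool).
Implicit Types (f : (E -> bool) -> R).

(* [averages] at a parameter ranging over all reals, so that it can be
   differentiated. *)
Definition averages_at q s f :=
  foldr (fun e f w =>
    q * f (set_edge e true w) + (1 - q) * f (set_edge e false w)) f s.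

Definition influence e f w : R := f (set_edge e true w) - f (set_edge e false w).

Lemma set_edgeK e b c w : set_edge e b (set_edge e c w) = set_edge e b w.
Proof. by apply/funext => x; rewrite /set_edge; case: eqP. Qed.

Lemma averages_at_influence q s e f w : e \notin s ->
  averages_at q s (influence e f) w = influence e (averages_at q s f) w.
Proof.
elim: s w => //= x s ih w; rewrite inE negb_or => /andP[ex es].
have C b c : set_edge x c (set_edge e b w) = set_edge e b (set_edge x c w).
  apply/funext => y; rewrite /set_edge.
  by have [->|//] := eqVneq y x; rewrite eq_sym (negbTE ex).
by rewrite !ih // /influence !C; ring.
Qed.

Let scalerE (a b : R) : a *: b = a * b.
Proof. by []. Qed.

(** By the product rule at the first edge: differentiating the two weights yields the influence of
    that edge, and differentiating the two averages is the induction hypothesis. *)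
Lemma russo s f w q : uniq s ->
  is_derive q 1 (fun r => averages_at r s f w)
    (\sum_(e <- s) averages_at q s (influence e f) w).
Proof.
elim: s w => [|e s ih] w /=; first by rewrite big_nil => _; exact: is_derive_cst.
move=> /andP[es us].
have D1 := ih (set_edge e true w) us; have D0 := ih (set_edge e false w) us.
set g1 := fun r => averages_at r s f (set_edge e true w).
set g0 := fun r => averages_at r s f (set_edge e false w).
rewrite (_ : (fun r => _) = (id : R -> R) * g1 + (cst 1 - id) * g0) //.
apply: is_derive_eq.
rewrite big_cons !averages_at_influence // /influence !set_edgeK.
rewrite big_split /= -!mulr_sumr (_ : (cst 1 - id) q = 1 - q) // /g1 /g0.
rewrite !scalerE.
ring.
Qed.

End Russo.

(** Edge by edge: for an increasing event the average with the edge open is at least the one with it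
    closed, so shifting weight to the open state increases the mean. *)
Lemma le_expect_param (R : realType) (E : choiceType) (p q : {i01 R})
    (s : seq E) (A : set (E -> bool)) : increasing_event A -> p%:num <= q%:num ->
  expect p s \1_A <= expect q s \1_A.
Proof.
move=> iA pq; rewrite /expect; elim: s (xpred0 : E -> bool) => //= e s ih w.
rewrite /average; set a := averages q s _ (set_edge e true w).
set b := averages q s _ (set_edge e false w).
have ab : b <= a.
  apply: averages_homo => [v v'|x]; first exact: increasing_indic.
  by rewrite /set_edge; case: eqP.
apply: (@le_trans _ _ (p%:num * a + (1 - p%:num) * b)).
  by apply: lerD; apply: ler_wpM2l; rewrite ?subr_ge0 //; exact: ih.
rewrite -subr_ge0 (_ : _ - _ = (q%:num - p%:num) * (a - b)); last by ring.
by rewrite mulr_ge0 ?subr_ge0.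
Qed.

Lemma le_prob_param (R : realType) (E : choiceType) (p q : {i01 R})
    (A : set (E -> bool)) : increasing_event A -> p%:num <= q%:num ->
  prob p A <= prob q A.
Proof.
move=> iA pq; apply: prob_le => s.
exact: le_trans (le_expect_param s iA pq) (expect_le_prob _ _ _).
Qed.

(** * Finite vertex sets and their edge boundaries *)

Section Boundary.
Variable X : multigraph.
Implicit Types (S : {fset vertex X}) (e : edge X) (a b : vertex X).

Definition inside S e := ((ends e).1 \in S) && ((ends e).2 \in S).

Definition boundary S e := ((ends e).1 \in S) != ((ends e).2 \in S).

(* Meaningful only for edges of the boundary of S. *)
Definition inner S e := if (ends e).1 \in S then (ends e).1 else (ends e).2.
Definition outer S e := if (ends e).1 \in S then (ends e).2 else (ends e).1.

Lemma insideE S e a b : ends e = (a, b) \/ ends e = (b, a) ->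
  inside S e = (a \in S) && (b \in S).
Proof. by rewrite /inside => -[->|->] //=; rewrite andbC. Qed.

Lemma boundaryP S e a b : ends e = (a, b) \/ ends e = (b, a) ->
  a \in S -> b \notin S -> [/\ boundary S e, inner S e = a & outer S e = b].
Proof.
rewrite /boundary /inner /outer => -[->|->] /= aS bS;
by rewrite aS (negbTE bS).
Qed.

Lemma boundary_ends S e : boundary S e -> [/\ inner S e \in S,
  outer S e \notin S & ends e = (inner S e, outer S e) \/
                       ends e = (outer S e, inner S e)].
Proof.
rewrite /boundary /inner /outer; case: (ends e) => a b /=.
have [aS|aS] := boolP (a \in S); have [bS|bS] := boolP (b \in S) => // _.
  by split=> //; left.
by split=> //; right.
Qed.

Definition connect_in S (o x : vertex X) : set (edge X -> bool) :=
  [set w | cluster o (restrict (inside S) w) x].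

Lemma connect_in_increasing S o x : increasing_event (connect_in S o x).
Proof. exact: restrict_increasing. Qed.

Lemma connect_in_determined S o x : determined_by (inside S) (connect_in S o x).
Proof. exact: restrict_determined. Qed.

End Boundary.

(** * The differential inequality for the probability of escape *)

Section LocallyFinite.
Variables (R : realType) (X : multigraph).
(** Local finiteness: [touch S] is a finite set that contains all edges meeting [S], and possibly
    others. *)
Variable touch : {fset vertex X} -> {fset edge X}.
Hypothesis touchP : forall S e,
  ((ends e).1 \in S) || ((ends e).2 \in S) -> e \in touch S.
Implicit Types (S L : {fset vertex X}) (e : edge X) (o x y : vertex X).
Implicit Types (w : edge X -> bool) (p : {i01 R}).

Definition cut S := [seq e <- touch S | boundary S e].

(** The boundary edge itself contributes no factor [p]: its state is not part of the event. *)
Definition flow p o S : R :=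
  \sum_(e <- cut S) prob p (connect_in S o (inner S e)).

Lemma le_flow p q o S : p%:num <= q%:num -> flow p o S <= flow q o S.
Proof.
move=> pq; apply: ler_sum => e _.
by apply: le_prob_param => //; exact: connect_in_increasing.
Qed.

Lemma inside_touch S L e : (S `<=` L)%fset -> inside S e -> e \in touch L.
Proof.
by move=> /fsubsetP SL /andP[/SL eL _]; apply: touchP; rewrite eL.
Qed.

Lemma boundary_touch S L e : (S `<=` L)%fset -> boundary S e -> e \in touch L.
Proof.
move=> /fsubsetP SL eS; apply: touchP; move: eS; rewrite /boundary.
have [/SL -> //|_] := boolP (_ \in S).
by have [/SL ->|//] := boolP (_ \in S); rewrite orbT.
Qed.

Lemma expect_connect_in p o S L x : (S `<=` L)%fset ->
  expect p (touch L) \1_(connect_in S o x) = prob p (connect_in S o x).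
Proof.
move=> SL; rewrite (@prob_depends _ _ p (touch L)) //.
  exact: connect_in_increasing.
move=> w w' ww'; apply: connect_in_determined => e /(inside_touch SL).
exact: ww'.
Qed.

Lemma sum_cut S L (f : edge X -> R) : (S `<=` L)%fset ->
  \sum_(e <- touch L | boundary S e) f e = \sum_(e <- cut S) f e.
Proof.
move=> SL; rewrite -big_filter; apply: perm_big; apply: uniq_perm.
- by rewrite filter_uniq ?fset_uniq.
- by rewrite filter_uniq ?fset_uniq.
move=> e; rewrite !mem_filter; have [eS /=|//] := boolP (boundary S e).
by rewrite !(boundary_touch _ eS) ?fsubset_refl.
Qed.

Definition trapped L w : {fset vertex X} :=
  [fset x in L | `[< ~ escape x L w >]]%fset.

Lemma trappedP L w x :
  reflect (x \in L /\ ~ escape x L w) (x \in trapped L w).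
Proof. by rewrite !inE; apply: (iffP andP) => -[xL /asboolP xw]. Qed.

Lemma trapped_step L w e a b : w e -> ends e = (a, b) \/ ends e = (b, a) ->
  a \in trapped L w -> b \in trapped L w.
Proof.
move=> we eab /trappedP[aL aw].
have eba : ends e = (b, a) \/ ends e = (a, b) by case: eab; [right|left].
have ab : cluster a w b by exact: cluster_open we eab (cluster_refl _ _).
apply/trappedP; split.
  by apply: contrapT => /negP bL; apply: aw; exists b.
by move=> [y yL by_]; apply: aw; exists y => //; exact: cluster_trans by_.
Qed.

(* Exploring the clusters that leave L reveals no edge inside the complementary
   set [trapped L w]. *)
Lemma trapped_determined L S :
  determined_by (predC (inside S)) [set w | trapped L w = S].
Proof.
suff H w w' : (forall e, ~~ inside S e -> w e = w' e) ->
    trapped L w = S -> trapped L w' = S.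
  by move=> w w' ww'; apply/propext; split; apply: H => // e /ww'.
move=> ww' wS; apply/fsetP => x; apply/idP/idP => [/trappedP[xL xw']|xS].
  rewrite -wS; apply/trappedP; split=> // -[y yL xy]; apply: xw'.
  exists y => //.
  (* The path is followed backwards from [y], which is outside [L]. All its vertices escape in [w],
     so they are not in [S]; its edges are thus not inside [S] and are open in [w'] too. *)
  move/cluster_sym: xy => yx; apply: cluster_sym; move: x yx {xL}.
  apply: cluster_rect => [|e a b ya we eab]; first exact: cluster_refl.
  apply: cluster_open (eab); rewrite -ww' // (insideE _ eab) negb_and.
  suff -> : a \notin S by [].
  rewrite -wS; apply/negP => /trappedP[_]; apply; exists y => //.
  exact: cluster_sym.
apply/trappedP; split; first by move: xS; rewrite -wS => /trappedP[].
move=> [y yL xy].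
have : y \in S.
  (* A path of [w'] that starts in [S] stays there: an edge that is not inside [S] would also be
     open in [w], where [trapped_step] applies. *)
  move: y xy {yL}; apply: cluster_rect => // e a b _ we eab aS.
  have [|eS] := boolP (inside S e); first by rewrite (insideE _ eab) => /andP[].
  by move: aS; rewrite -wS; apply: trapped_step eab; rewrite ww'.
by rewrite -wS => /trappedP[yL' _]; rewrite yL' in yL.
Qed.

(* When o is trapped, opening a boundary edge of the trapped set whose inner end
   is joined to o lets o escape. *)
Lemma le_influence_escape L w e o :
  \sum_(S <- fpowerset L | (o \in S) && boundary S e)
    \1_[set w | trapped L w = S] w * \1_(connect_in S o (inner S e)) w <=
  influence e (\1_(escape o L) : _ -> R) w.
Proof.
set T := trapped L w.
have TL : T \in fpowerset L by rewrite fpowersetE; apply/fsubsetP => x /trappedP[].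
have influence0 : 0 <= influence e (\1_(escape o L) : _ -> R) w.
  rewrite subr_ge0; apply: increasing_indic; first exact: escape_increasing.
  by move=> x; rewrite /set_edge; case: eqP.
rewrite big_mkcond (bigD1_seq T) ?fset_uniq //= big1 ?addr0 => [|S ST]; last first.
  by case: ifP => // _; rewrite indic0 ?mul0r // => TS; rewrite -TS eqxx in ST.
case: ifP => // /andP[oT /boundary_ends[iT uT eT]].
rewrite [\1__ w]indic1 // mul1r.
have [c|c] := pselect (connect_in T o (inner T e) w); last by rewrite indic0.
rewrite indic1 // /influence.
have we b : w e = b -> set_edge e b w = w.
  by move=> <-; apply/funext => x; rewrite /set_edge; case: eqP => // ->.
have [_ now] := trappedP _ _ _ oT.
(* The edge is closed in [w], since otherwise its outer end would be trapped as well. Hence closing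
   it changes nothing, and [o] does not escape. *)
have wF : w e = false.
  apply/negP => we1; have := trapped_step we1 eT iT.
  by rewrite (negbTE uT).
rewrite (we _ wF) [X in _ - X]indic0 // subr0 indic1 //.
have ww' (d : edge X) : w d -> set_edge e true w d by rewrite /set_edge; case: eqP.
have oi : cluster o (set_edge e true w) (inner T e).
  by apply: le_cluster (cluster_restrictW c).
have ou : cluster o (set_edge e true w) (outer T e).
  by apply: cluster_open oi; [|exact: eT]; rewrite /set_edge eqxx.
have [uL|uL] := boolP (outer T e \in L); last by exists (outer T e).
have [z zL uz] : escape (outer T e) L w.
  by apply: contrapT => uw; move/negP: uT; apply; apply/trappedP.
exists z => //; apply: cluster_trans ou _; exact: le_cluster uz.
Qed.

(** The event that [o] does not escape is split according to the trapped set [S]. The connection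
    inside [S] is independent of the event that [S] is the trapped set, so summing over the boundary
    of [S] produces the factor [flow p o S], which is at least 1. *)
Lemma expect_influence_escape p L o : o \in L ->
    (forall S, o \in S -> 1 <= flow p o S) ->
  1 - expect p (touch L) \1_(escape o L) <=
  \sum_(e <- touch L) expect p (touch L) (influence e \1_(escape o L)).
Proof.
move=> oL flow1; set F := touch L.
pose t S := [set w | trapped L w = S].
have -> : 1 - expect p F \1_(escape o L) =
    \sum_(S <- fpowerset L | o \in S) expect p F \1_(t S).
  apply: (@addIr _ (expect p F \1_(escape o L))); rewrite subrK -expect_sum.
  rewrite -[LHS](expectC p F 1) /expect.
  rewrite -[RHS]/((fun w => averages p F _ w + averages p F _ w) _) -averagesD.
  congr (averages _ _ _ _); apply/funext => w.
  have TL : trapped L w \in fpowerset L.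
    by rewrite fpowersetE; apply/fsubsetP => x /trappedP[].
  rewrite big_mkcond (bigD1_seq (trapped L w)) ?fset_uniq //= big1 ?addr0.
    have [esc|nesc] := pselect (escape o L w).
      by rewrite [X in _ + X]indic1 //; case: ifP => [/trappedP[]|_] //; rewrite add0r.
    rewrite [X in _ + X]indic0 // addr0 ifT ?indic1 //.
    exact/trappedP.
  by move=> S ST; case: ifP => // _; rewrite indic0 // => TS; rewrite -TS eqxx in ST.
apply: (@le_trans _ _ (\sum_(e <- F)
    \sum_(S <- fpowerset L | (o \in S) && boundary S e) expect p F (fun w =>
      \1_(t S) w * \1_(connect_in S o (inner S e)) w))); last first.
  apply: ler_sum => e _; rewrite -expect_sum; apply: le_expect => w.
  exact: le_influence_escape.
rewrite (exchange_big_dep (fun S => o \in S)) /=; last by move=> e S _ /andP[].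
rewrite big_seq_cond [leRHS]big_seq_cond; apply: ler_sum => S /andP[].
rewrite fpowersetE => SL oS.
have EM e : expect p F (fun w => \1_(t S) w * \1_(connect_in S o (inner S e)) w)
    = prob p (connect_in S o (inner S e)) * expect p F \1_(t S).
  under eq_fun do rewrite mulrC.
  rewrite (@expectM _ _ p (inside S)) ?expect_connect_in //.
    exact/determined_indic/connect_in_determined.
  exact/determined_indic/trapped_determined.
under eq_bigr do rewrite EM.
under eq_bigl do rewrite oS.
rewrite -mulr_suml sum_cut // ler_peMl ?expect_indic_ge0 //.
exact: flow1.
Qed.

Lemma theta_lower p q o L : o \in L -> p%:num < q%:num ->
    (forall S, o \in S -> 1 <= flow p o S) ->
  (q%:num - p%:num) / 2 <= prob q (escape o L).
Proof.
move=> oL pq flow1; set F := touch L.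
pose g r := averages_at r F (\1_(escape o L) : _ -> R) xpred0.
pose dg r := \sum_(e <- F)
  averages_at r F (influence e (\1_(escape o L) : _ -> R)) xpred0.
have Dg (r : R) : is_derive r 1 g (dg r) by apply: russo; exact: fset_uniq.
have [|c cpq] := MVT pq (fun r _ => Dg r).
  by apply: derivable_within_continuous => r _; exact: (@ex_derive _ _ _ _ _ _ _ (Dg r)).
have [c0 cq] : p%:num <= c /\ c <= q%:num.
  by move: cpq; rewrite in_itv /= => /andP[/ltW -> /ltW ->].
have p0 : 0 <= p%:num by [].
have c1 : c <= 1 by rewrite (le_trans cq).
pose r := Itv01 (le_trans p0 c0) c1.
(* The hypothesis at [p] carries over to the intermediate parameter [c], because the flow increases
   with the parameter. *)
have flow1r S : o \in S -> 1 <= flow r o S.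
  by move=> /flow1 /le_trans; apply; exact: le_flow.
have dgc : 1 - g c <= dg c := expect_influence_escape oL flow1r.
have gc : g c <= g q%:num.
  by apply: (@le_expect_param _ _ r q) => //; exact: escape_increasing.
have gp : 0 <= g p%:num by exact: expect_indic_ge0.
have gq : g q%:num <= prob q (escape o L) by exact: expect_le_prob.
have q1 : q%:num <= 1 by [].
(* With d = q - p, the mean value theorem gives g(q) >= d (1 - g(c)) >= d (1 - g(q)), hence g(q) >=
   d / (1 + d) >= d / 2, as d <= 1. *)
move=> gE; apply: le_trans gq; nra.
Qed.

End LocallyFinite.

Lemma determinedS (E : choiceType) (T : Type) (P Q : pred E)
    (f : (E -> bool) -> T) :
  (forall e, P e -> Q e) -> determined_by P f -> determined_by Q f.
Proof. by move=> PQ Pf w w' ww'; apply: Pf => e /PQ; exact: ww'. Qed.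

(** The inequality is strict when [e] lies outside [s] and [p] is positive, since [e] then counts as
    closed. *)
Lemma expect_open_le (R : realType) (E : choiceType) (p : {i01 R}) (s : seq E)
    (e : E) : expect p s \1_[set w | w e] <= p%:num.
Proof.
apply: le_trans (expect_catr p s [:: e] _) _.
  by move=> w w' ww'; apply: le_indic; exact: ww'.
rewrite /expect averages_cat /= (_ : average _ _ _ = fun=> p%:num).
  by rewrite averages1.
apply/funext => w; rewrite /average !indicE.
rewrite mem_set /set_edge /= ?eqxx // memNset /= ?eqxx //.
by rewrite mulr0 mulr1 addr0.
Qed.

(** * Cutting open paths at the cluster of the origin in a finite set *)

Section Core.
Variables (R : realType) (X : multigraph).
Variable touch : {fset vertex X} -> {fset edge X}.
Hypothesis touchP : forall S e,
  ((ends e).1 \in S) || ((ends e).2 \in S) -> e \in touch S.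
Implicit Types (S C : {fset vertex X}) (e : edge X) (o x y v : vertex X).
Implicit Types (w : edge X -> bool) (p : {i01 R}).

Definition avoid C e := ((ends e).1 \notin C) && ((ends e).2 \notin C).

Lemma avoidE C e x y : ends e = (x, y) \/ ends e = (y, x) ->
  avoid C e = (x \notin C) && (y \notin C).
Proof. by rewrite /avoid => -[->|->] //=; rewrite andbC. Qed.

Definition core S o w : {fset vertex X} :=
  [fset x in S | `[< connect_in S o x w >]]%fset.

Lemma coreP S o w x : reflect (x \in S /\ connect_in S o x w) (x \in core S o w).
Proof. by rewrite !inE; apply: (iffP andP) => -[xS /asboolP xw]. Qed.

Lemma core_sub S o w : core S o w \in fpowerset S.
Proof. by rewrite fpowersetE; apply/fsubsetP => x /coreP[]. Qed.

Lemma core_step S o w e x y : inside S e -> w e ->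
  ends e = (x, y) \/ ends e = (y, x) -> x \in core S o w -> y \in core S o w.
Proof.
move=> eS we exy /coreP[_ ox]; apply/coreP; split.
  by move: eS; rewrite (insideE _ exy) => /andP[].
by apply: cluster_open exy ox; rewrite /restrict eS.
Qed.

(** Exploring the cluster of [o] in [S] examines only edges inside [S] with an end in the cluster
    found. *)
Lemma core_determined S o C : o \in S ->
  determined_by [pred e | inside S e && ~~ avoid C e]
    [set w | core S o w = C].
Proof.
move=> oS; suff H w w' : (forall e, inside S e && ~~ avoid C e -> w e = w' e) ->
    core S o w = C -> core S o w' = C.
  by move=> w w' ww'; apply/propext; split; apply: H => // e /ww'.
move=> ww' wC; have oC : o \in C.
  by rewrite -wC; apply/coreP; split => //; exact: cluster_refl.
apply/fsetP => x; apply/idP/idP => [/coreP[_]|].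
  move: x; apply: cluster_rect => // e x y _ /andP[eS we] exy xC.
  rewrite -wC; apply: (core_step eS _ exy); last by rewrite wC.
  by rewrite ww' // eS (avoidE _ exy) xC.
rewrite -{1}wC => /coreP[xS ox]; apply/coreP; split=> // {xS}.
rewrite /connect_in /=; move: x ox.
apply: cluster_rect => [|e x y ox /andP[eS we] exy ox'].
  exact: cluster_refl.
apply: cluster_open (exy) ox'; rewrite /restrict eS -ww' // eS (avoidE _ exy).
rewrite (_ : x \in C) // -wC; apply/coreP; split=> //.
by move: eS; rewrite (insideE _ exy) => /andP[].
Qed.

(* The last edge of a path leaving the core crosses the boundary of S and the
   rest of the path avoids the core. *)
Lemma cluster_core S o w v : o \in S -> v \notin S -> cluster o w v ->
  exists2 e, e \in cut touch S & [/\ inner S e \in core S o w, w e &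
    cluster (outer S e) (restrict (avoid (core S o w)) w) v].
Proof.
move=> oS vS ov; set C := core S o w.
suff : v \in C \/ exists2 e, e \in cut touch S & [/\ inner S e \in C, w e &
    cluster (outer S e) (restrict (avoid C) w) v].
  by case=> // /coreP[vS']; rewrite vS' in vS.
move: v ov {vS}; apply: cluster_rect => [|e x y ox we exy IH].
  by left; apply/coreP; split => //; exact: cluster_refl.
have [yC|yC] := boolP (y \in C); [by left|right].
have [xC|xC] := boolP (x \in C); last first.
  case: IH => [xC'|[d dS [dC wd dx]]]; first by rewrite xC' in xC.
  exists d => //; split=> //; apply: cluster_open (exy) dx.
  by rewrite /restrict (avoidE _ exy) xC yC.
have xS : x \in S by case/coreP: xC.
have yS : y \notin S.
  apply: contra yC => yS; apply: (core_step _ we exy) xC.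
  by rewrite (insideE _ exy) xS.
have [eS ex ey] := boundaryP exy xS yS.
exists e; first by rewrite mem_filter eS (boundary_touch touchP (fsubset_refl S) eS).
by rewrite ex ey; split=> //; exact: cluster_refl.
Qed.

(** A union bound over the crossing edge given by [cluster_core] and over the possible values [C] of
    the core. *)
Lemma connect_prob_core p S o v : o \in S ->
  connect_prob p o v <= (v \in S)%:R + p%:num *
    \sum_(e <- cut touch S) prob p (connect_in S o (inner S e)) *
      connect_prob p (outer S e) v.
Proof.
move=> oS; have [vS|vS] := boolP (v \in S).
  rewrite (le_trans (prob_le1 _ _)) // lerDl mulr_ge0 // sumr_ge0 // => e _.
  by rewrite mulr_ge0 ?prob_ge0.
rewrite add0r; apply: prob_le => s.
pose t C : set (edge X -> bool) := [set w | core S o w = C].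
pose u e : set (edge X -> bool) := [set w | w e].
pose c C e : set (edge X -> bool) :=
  [set w | cluster (outer S e) (restrict (avoid C) w) v].
apply: (@le_trans _ _ (expect p s (fun w => \sum_(e <- cut touch S)
    \sum_(C <- fpowerset S | inner S e \in C)
      \1_(t C) w * (\1_(u e) w * \1_(c C e) w)))).
  apply: le_expect => w.
  have term0 C e : 0 <= \1_(t C) w * (\1_(u e) w * \1_(c C e) w) :> R.
    by rewrite !mulr_ge0.
  have [ov|nov] := pselect (cluster o w v); last first.
    rewrite indic0 // sumr_ge0 // => e _.
    by rewrite sumr_ge0 // => C _; exact: term0.
  have [e eS [ie we oe]] := cluster_core oS vS ov.
  rewrite indic1 // (big_rem e) //= ler_wpDr ?sumr_ge0 // => [d _|].
    by rewrite sumr_ge0 // => C _; exact: term0.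
  rewrite big_mkcond (big_rem (core S o w)) ?core_sub //= ie.
  rewrite indic1 // indic1 // indic1 // !mulr1 ler_wpDr // sumr_ge0 // => C _.
  by case: ifP => // _; exact: term0.
rewrite expect_sum mulr_sumr; rewrite big_seq [leRHS]big_seq.
apply: ler_sum => e; rewrite mem_filter => /andP[eS _].
have [ieS ueS ends_e] := boundary_ends eS.
rewrite expect_sum.
(* The three events depend on disjoint sets of edges: those inside [S] that meet [C], the boundary
   edge [e] alone, and those that avoid [C]. *)
have EM C : inner S e \in C -> expect p s (fun w =>
    \1_(t C) w * (\1_(u e) w * \1_(c C e) w)) <=
    expect p s \1_(t C) * (p%:num * connect_prob p (outer S e) v).
  move=> ieC; pose Q : pred (edge X) := [pred e | inside S e && ~~ avoid C e].
  have De : determined_by (pred1 e) (u e).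
    by move=> w w' ww'; rewrite /u /= ww' //= eqxx.
  have Dc : determined_by (avoid C) (c C e) by exact: restrict_determined.
  have eA : ~~ avoid C e by rewrite (avoidE _ ends_e) ieC.
  have eI : ~~ inside S e by rewrite (insideE _ ends_e) (negbTE ueS) andbF.
  rewrite (@expectM _ _ p Q).
  - apply: ler_wpM2l; first exact: expect_indic_ge0.
    rewrite (@expectM _ _ p (pred1 e)).
    + apply: ler_pM; rewrite ?expect_indic_ge0 ?expect_open_le //.
      apply: le_trans (expect_le_prob _ _ _) _; apply: le_prob => w.
      exact: cluster_restrictW.
    + exact: determined_indic.
    + apply: determined_indic; apply: determinedS Dc => d dA /=.
      by apply: contraNneq eA => <-.
  - exact/determined_indic/core_determined.
  - rewrite (_ : (fun w => _) = \1_(u e `&` c C e)); last first.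
      by apply/funext => w; rewrite indicM.
    apply: determined_indic => w w' ww'; congr (_ /\ _).
      by apply: De => d /eqP->; apply: ww'; rewrite /= /Q /= (negbTE eI).
    by apply: Dc => d dA; apply: ww'; rewrite /= /Q /= dA andbF.
apply: le_trans (ler_sum _ EM) _.
rewrite -mulr_suml mulrCA ler_wpM2l // ler_wpM2r ?prob_ge0 //.
(* Resummation over [C]: the events that the core equals [C], for [C] containing the inner end, are
   disjoint and imply that [o] is joined to this end in [S]. *)
rewrite -expect_sum; apply: le_trans (expect_le_prob p s _).
apply: le_expect => w; rewrite big_mkcond (bigD1_seq (core S o w)) ?core_sub
  ?fset_uniq //= big1 ?addr0 => [|C CS].
  case: ifP => // /coreP[_ oe]; rewrite [leRHS]indic1 //; exact: indic_le1.
by case: ifP => // _; rewrite indic0 // => tC; rewrite -tC eqxx in CS.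
Qed.

End Core.

Lemma cluster_map (X Y : multigraph) (f : vertex X -> vertex Y)
    (h : edge X -> edge Y) (w : edge Y -> bool) (x y : vertex X) :
  (forall e, ends (h e) = (f (ends e).1, f (ends e).2)) ->
  cluster x (w \o h) y -> cluster (f x) w (f y).
Proof.
move=> fh; move: y; apply: cluster_rect => [|e a b _ we eab].
  exact: cluster_refl.
apply: (@cluster_open Y _ w (h e)) => //; rewrite fh.
by case: eab => ->; [left|right].
Qed.

(** * Cayley graphs: translation invariance and finite mean cluster size below the critical point *)

Section Cayley.
Variables (R : realType) (G : groupType) (S : {fset G}).
Local Notation X := (cayley_graph S).
Local Notation o := (1%g : vertex X).
Implicit Types (p : {i01 R}) (g x y u v : G).
Local Open Scope group_scope.

Definition translate g (e : edge X) : edge X := (g * e.1, e.2).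

Lemma translateK g : cancel (translate g) (translate g^-1).
Proof. by case=> x s; rewrite /translate /= mulKg. Qed.

Lemma cluster_translate g x y (w : edge X -> bool) :
  cluster (g * x : vertex X) w (g * y) <->
  cluster (x : vertex X) (w \o translate g) y.
Proof.
have H h a b (v : edge X -> bool) : cluster (a : vertex X) (v \o translate h) b ->
    cluster (h * a : vertex X) v (h * b).
  by apply: (@cluster_map X X) => -[z s] /=; rewrite mulgA.
split; last exact: H.
have wE : w = (w \o translate g) \o translate g^-1.
  by apply/funext => e /=; rewrite -{1}[g]invgK translateK.
by rewrite {1}wE => /H; rewrite !mulKg.
Qed.

Lemma connect_prob_translate p g x y :
  connect_prob p (g * x : vertex X) (g * y) = connect_prob p (x : vertex X) y.
Proof.
rewrite /connect_prob -[RHS](prob_pullback p _ (can_inj (translateK g))).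
congr prob; rewrite eqEsubset; split => w /=; by move/cluster_translate.
Qed.

(** An edge is recorded at its starting point, so one that ends at [x] through the generator [s] is
    stored at [x * s^-1]. *)
Definition touching (T : {fset vertex X}) : {fset edge X} :=
  [fset e in [seq (x, s) | x <- T, s <- enum {: S}] ++
             [seq ((x : G) * (val s)^-1, s) | x <- T, s <- enum {: S}]]%fset.

Lemma touchingP (T : {fset vertex X}) (e : edge X) :
  ((ends e).1 \in T) || ((ends e).2 \in T) -> e \in touching T.
Proof.
case: e => x s /= xT; rewrite in_fset /= mem_cat.
case/orP: xT => xT; apply/orP; [left|right].
  by apply/allpairsP; exists (x, s); rewrite mem_enum.
by apply/allpairsP; exists (x * val s, s); rewrite mem_enum /= mulgK.
Qed.

(** Let M be the supremum over [u] of the mean number of points of [r] joined to [u]. Cutting at the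
    translate of [T] by [u] gives M <= #|T| + flow * M. Since [r] is finite, so is M, and the
    inequality can be solved for it. *)
Lemma susceptibility_bound p (T : {fset vertex X}) (r : seq G) : o \in T ->
    (flow touching p o T < 1)%R -> uniq r ->
  (\sum_(v <- r) connect_prob p o v <=
    #|` T|%:R / (1 - flow touching p o T))%R.
Proof.
move=> T1 flow1 ur; set phi := flow touching p _ T.
pose c u := (\sum_(v <- r) connect_prob p (u : vertex X) v)%R.
have hsc : has_sup (range c).
  split; first by exists (c 1), 1.
  exists (size r)%:R => _ [u _ <-]; rewrite /c -sum1_size natr_sum.
  by apply: ler_sum => v _; exact: prob_le1.
pose M := sup (range c).
have cM u : (c u <= M)%R by apply: sup_upper_bound => //; exists u.
suff MT : (M <= #|` T|%:R + phi * M)%R.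
  rewrite ler_pdivlMr ?subr_gt0 //; apply: (@le_trans _ _ (M * (1 - phi))%R).
    by apply: ler_wpM2r (cM 1); rewrite subr_ge0 ltW.
  by rewrite mulrBr mulr1 lerBlDr mulrC.
apply: ge_sup => [|_ [u _ <-]]; first by exists (c 1), 1.
have M0 : (0 <= M)%R.
  by apply: le_trans (cM 1); apply: sumr_ge0 => v _; exact: prob_ge0.
apply: (@le_trans _ _ (\sum_(v <- r) (((u^-1 * v)%g \in T)%:R +
    \sum_(e <- cut touching T) prob p (connect_in T o (inner T e)) *
      connect_prob p ((u * outer T e)%g : vertex X) v))%R).
  apply: ler_sum => v _.
  rewrite -[v in leLHS](mulVKg u) -{1}[u]mulg1 connect_prob_translate.
  apply: le_trans (connect_prob_core touchingP p _ T1) _.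
  (* The factor [p] is bounded by 1. *)
  rewrite lerD2l; apply: (le_trans (ler_piMl _ _)) => //.
    by apply: sumr_ge0 => e _; rewrite mulr_ge0 ?prob_ge0.
  apply: ler_sum => e _; rewrite ler_wpM2l ?prob_ge0 //.
  by rewrite -(connect_prob_translate _ u) mulVKg.
rewrite big_split /= lerD //.
  (* At most #|T| entries [v] of [r] satisfy u^-1 v in [T], since [r] has no repetition. *)
  rewrite -natr_sum ler_nat -(big_map (fun v => u^-1 * v) predT
    (fun z => nat_of_bool (z \in T))) -big_mkcond /= sum1_count -size_filter.
  apply: uniq_leq_size => [|z]; last by rewrite mem_filter => /andP[].
  by rewrite filter_uniq // map_inj_uniq //; exact: mulgI.
rewrite exchange_big /= /phi mulr_suml; apply: ler_sum => e _.
by rewrite -mulr_sumr ler_wpM2l ?prob_ge0 //; exact: cM.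
Qed.

Hypothesis genS : generates S.

Definition word_eval (t : seq (bool * S)) : G :=
  foldr (fun bs g => (if bs.1 then val bs.2 else (val bs.2)^-1) * g) 1 t.

(** Words in the generators and their inverses form a countable type; decoding the numbers below [n]
    lists the group without reference to a metric. *)
Definition word_list (n : nat) : seq G :=
  pmap (fun i => omap word_eval (choice.unpickle i)) (iota 0 n).

(** The identity is added so that the origin belongs to every set of the exhaustion, as
    [theta_lower] requires. *)
Definition word_ball (n : nat) : {fset G} :=
  (1%g |` [fset g in word_list n])%fset.

Lemma in_word_ball n x : (x \in word_ball n) = (x == 1) || (x \in word_list n).
Proof. by rewrite in_fset1U in_fset. Qed.

Lemma word_ball1 n : 1 \in word_ball n.
Proof. by rewrite in_word_ball eqxx. Qed.

Lemma word_evalP g : exists t, word_eval t = g.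
Proof.
have evalM s t : word_eval (s ++ t) = word_eval s * word_eval t.
  by elim: s => [|b s ih] /=; rewrite ?mul1g // ih mulgA.
pose H : {pred G} := fun g => `[< exists t, word_eval t = g >].
suff /asboolP : g \in H by [].
apply: genS => [|s sS]; last first.
  by apply/asboolP; exists [:: (true, [` sS]%fset)]; rewrite /= mulg1.
split; first by apply/asboolP; exists [::].
move=> x y /asboolP[s <-] /asboolP[t <-]; apply/asboolP.
suff [t' ->] : exists t', (word_eval t)^-1 = word_eval t'.
  by exists (s ++ t'); rewrite evalM.
elim: t => [|[b a] t [t' ih]] /=; first by exists [::]; rewrite invg1.
exists (t' ++ [:: (~~ b, a)]); rewrite evalM invgM ih /= mulg1.
by case: b => //=; rewrite invgK.
Qed.

Lemma word_ball_exhausting : exhausting (word_ball : nat -> seq G).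
Proof.
split=> [m n mn x|x].
  rewrite !in_word_ball => /predU1P[->|]; rewrite ?eqxx // !mem_pmap => /mapP[i im ->].
  apply/orP; right; apply/mapP; exists i => //.
  by move: im; rewrite !mem_iota /= !add0n => /leq_trans; exact.
have [t <-] := word_evalP x; exists (choice.pickle t).+1.
rewrite in_word_ball mem_pmap; apply/orP; right; apply/mapP; exists (choice.pickle t).
  by rewrite mem_iota leq0n add0n ltnS leqnn.
by rewrite choice.pickleK.
Qed.

Definition edge_ball n : seq (edge X) :=
  [seq (x, s) | x <- word_ball n, s <- enum {: S}].

Lemma edge_ball_exhausting : exhausting edge_ball.
Proof.
have [Lm Lx] := word_ball_exhausting; split=> [m n mn e|[x s]].
  move=> /allpairsP[[x s] [/= xm sS ->]]; apply/allpairsP.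
  by exists (x, s); split=> //=; exact: Lm xm.
have [n xn] := Lx x; exists n; apply/allpairsP.
by exists (x, s); rewrite mem_enum.
Qed.

Lemma subcritical_bound p :
    (p%:num < critical_probability R o)%R ->
  exists K, forall r : seq G, uniq r ->
    (\sum_(v <- r) connect_prob p o v <= K)%R.
Proof.
rewrite /critical_probability; case: ifPn => [/asboolP finG _|_ ppc].
  exists (#|` fset_set [set: G]|%:R)%R => r ur.
  apply: (@le_trans _ _ (size r)%:R%R).
    by rewrite -sum1_size natr_sum; apply: ler_sum => v _; exact: prob_le1.
  rewrite ler_nat; apply: uniq_leq_size => // x _.
  by rewrite in_fset_set ?inE.
set A := [set _%:num | _ in _] in ppc.
have A0 : A !=set0.
  (* If no parameter percolated, the infimum would take its default value 0, and no [p] lies below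
     0. *)
  apply/set0P/negP => /eqP A0; move: ppc; rewrite A0 inf0.
  by apply/negP; rewrite -leNgt.
have lbA : has_inf A by split=> //; exists 0%R => _ [q _ <-].
have pc1 : (inf A <= 1)%R.
  case: (A0) => a Aa; apply: le_trans (ge_inf lbA.2 Aa) _.
  by case: Aa => q _ <-.
(* If all flows at [p] were at least 1, percolation would occur at this midpoint, which lies below
   the infimum. *)
pose c := ((p%:num + inf A) / 2)%R.
have p0 : (0 <= p%:num)%R by [].
have [c0 c1 pc cA] : [/\ 0 <= c, c <= 1, p%:num < c & c < inf A]%R.
  by rewrite /c; split; lra.
pose q := Itv01 c0 c1.
have [flow1|] := pselect (forall T, o \in T -> (1 <= flow touching p o T)%R).
  suff /(ge_inf lbA.2) : A c by rewrite leNgt cA.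
  exists q => //; apply: (theta_escape edge_ball_exhausting word_ball_exhausting
    (c := (c - p%:num) / 2)%R) => [|n]; first by rewrite divr_gt0 // subr_gt0.
  exact: (@theta_lower _ _ _ touchingP p q _ _ (word_ball1 n) pc flow1).
move=> /existsNP[T /not_implyP[T1 /negP]]; rewrite -ltNge => flow1.
by eexists => r ur; exact: susceptibility_bound T1 flow1 ur.
Qed.

End Cayley.

(** * Free products *)

Section EsumScale.
Variables (R : realType) (T : choiceType).
Local Open Scope ereal_scope.

(** One inequality holds for every positive factor; applied to the inverse of [c] it yields the
    other. *)
Lemma esumZl (P : set T) (a : T -> \bar R) (c : R) : (0 <= c)%R ->
  (forall x, 0 <= a x) ->
  \esum_(x in P) (c%:E * a x) = c%:E * \esum_(x in P) a x.
Proof.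
have le (d : R) (b : T -> \bar R) : (0 < d)%R -> (forall x, 0 <= b x) ->
    \esum_(x in P) (d%:E * b x) <= d%:E * \esum_(x in P) b x.
  move=> d0 b0; apply: ge_ereal_sup => _ [A [fA AP] <-].
  rewrite fsbig_finite //= -ge0_sume_distrr //.
  apply: lee_wpmul2l; first by rewrite lee_fin ltW.
  by apply: esum_ge; exists A => //; rewrite fsbig_finite.
rewrite le_eqVlt => /predU1P[<-|c0] a0.
  by rewrite mul0e esum1 // => x _; rewrite mul0e.
apply/eqP; rewrite eq_le le //=.
have ci0 : (0 < c^-1)%R by rewrite invr_gt0.
rewrite -lee_pdivlMl //; apply: le_trans (le _ _ ci0 _).
  apply: le_esum => x _.
  by rewrite muleA -EFinM mulVf ?mul1e // gt_eqF.
by move=> x; rewrite mule_ge0 // lee_fin ltW.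
Qed.

End EsumScale.

(** * Factorization of connection probabilities along a retraction onto a factor *)

Section Retraction.
Variables (R : realType) (p : {i01 R}) (G H : groupType).
(** To be applied with [G] the free product, [iota] the inclusion of a factor [H] and [pi] the
    leading letter in [H]. The map [pi] is only assumed to commute with left multiplication by
    [H]. *)
Variables (S : {fset G}) (T : {fset H}) (iota : H -> G) (pi : G -> H).
Local Notation X := (cayley_graph S).
Local Notation Y := (cayley_graph T).
Local Open Scope group_scope.
Local Notation oX := (1%g : vertex X).
Local Notation oY := (1%g : vertex Y).

Hypothesis iotaM : {morph iota : x y / x * y}.
Hypothesis pi1 : pi 1 = 1.
Hypothesis piM : forall h z, pi (iota h * z) = h * pi z.
Hypothesis iota_gen : forall t, t \in T -> iota t \in S.
(* An edge of X either lies in the copy iota H of H, or is collapsed by pi. *)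
Hypothesis pi_step : forall z s, s \in S ->
  pi (z * s) = pi z \/ (z = iota (pi z) /\ exists2 t, t \in T & s = iota t).

Lemma iota1 : iota 1 = 1.
Proof. by apply: (@mulgI _ (iota 1)); rewrite -iotaM !mulg1. Qed.

Lemma iotaK : cancel iota pi.
Proof. by move=> h; rewrite -[iota h]mulg1 piM pi1 mulg1. Qed.

Definition iota_edge (e : edge Y) : edge X :=
  (iota e.1, [` iota_gen (valP e.2)]%fset).

Lemma ends_iota_edge e :
  ends (iota_edge e) = (iota (ends e).1, iota (ends e).2).
Proof. by case: e => x t; rewrite /= iotaM. Qed.

Lemma iota_edge_inj : injective iota_edge.
Proof.
move=> [x s] [y t] [/(can_inj iotaK) -> st]; congr pair.
by apply/val_inj/(can_inj iotaK).
Qed.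

Definition iota_edges : pred (edge X) := fun e =>
  `[< exists d, iota_edge d = e >].

Lemma cluster_iota (w : edge X -> bool) h :
  cluster oX (restrict iota_edges w) (iota h) <->
  cluster oY (w \o iota_edge) h.
Proof.
split.
  suff Q z : cluster oX (restrict iota_edges w) z ->
      cluster oY (w \o iota_edge) (pi z) by move=> /Q; rewrite iotaK.
  move: z; apply: cluster_rect => [|e a b _ /andP[/asboolP[d <-] wd] eab].
    by rewrite pi1; exact: cluster_refl.
  apply: (@cluster_open Y _ _ d) => //; move: eab; rewrite ends_iota_edge.
  by rewrite [ends d]surjective_pairing => -[] [<- <-]; rewrite !iotaK; [left|right].
rewrite (_ : w \o _ = restrict iota_edges w \o iota_edge); last first.
  by apply/funext => d; rewrite /restrict /= (_ : iota_edges _) //; apply/asboolP; exists d.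
by move=> /(cluster_map ends_iota_edge); rewrite iota1.
Qed.

(** Along the path, an edge outside the copy of [H] leaves the projection fixed and extends the
    second connection. An edge of the copy joins two points fixed by the retraction: it extends the
    first connection and makes the second trivial. *)
Lemma cluster_retract (w : edge X -> bool) h z :
  cluster (iota h : vertex X) w z ->
  cluster (iota h : vertex X) (restrict iota_edges w) (iota (pi z)) /\
  cluster (iota (pi z) : vertex X) (restrict (predC iota_edges) w) z.
Proof.
move: z; apply: cluster_rect => [|e a b _ we eab [ha az]].
  by rewrite iotaK; split; exact: cluster_refl.
have [eH|eH] := boolP (iota_edges e).
  have /asboolP[d de] := eH.
  have [aK bK] : iota (pi a) = a /\ iota (pi b) = b.
    by move: eab; rewrite -de ends_iota_edge => -[] [<- <-]; rewrite !iotaK.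
  rewrite bK; rewrite aK in ha; split; last exact: cluster_refl.
  by apply: cluster_open eab ha; rewrite /restrict eH.
have piE : pi b = pi a.
  have : pi (ends e).2 = pi (ends e).1.
    case: e {we eab} eH => z s /=; have [//|[zK [t tT st]] /negP[]] :=
      pi_step z (valP s).
    apply/asboolP; exists (pi z, [` tT]%fset); rewrite /iota_edge /= -zK.
    by congr pair; apply: val_inj.
  by case: eab => -> /=.
rewrite piE; split=> //; apply: cluster_open eab az.
by rewrite /restrict /= eH.
Qed.

Lemma connect_prob_iota h u : pi u = 1 ->
  connect_prob p oX (iota h * u) =
  (connect_prob p oY h * connect_prob p oX u)%R.
Proof.
move=> pu.
have hu : pi (iota h * u) = h by rewrite piM pu mulg1.
pose A : set (edge X -> bool) :=
  [set w | cluster oX (restrict iota_edges w) (iota h)].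
pose B : set (edge X -> bool) := [set w |
  cluster (iota h : vertex X) (restrict (predC iota_edges) w) (iota h * u)].
have -> : connect_prob p oY h = prob p A.
  rewrite /connect_prob -(prob_pullback p _ iota_edge_inj); congr prob.
  by rewrite eqEsubset; split => w /=; rewrite /A /=; move/cluster_iota.
(* After translation by [iota h] both ends project to [h], so by [cluster_retract] the connection
   may be taken outside the copy. *)
have -> : connect_prob p oX u = prob p B.
  rewrite -(connect_prob_translate S p (iota h)) mulg1; congr prob.
  rewrite eqEsubset; split => w /=; last exact: cluster_restrictW.
  by move=> /cluster_retract[_]; rewrite hu.
rewrite -(@prob_setI _ _ p iota_edges); first last.
- exact: restrict_determined.
- exact: restrict_determined.
- exact: restrict_increasing.
- exact: restrict_increasing.
congr prob; rewrite eqEsubset; split => w /=.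
  rewrite -[X in cluster X](iota1) => /cluster_retract[].
  by rewrite hu iota1.
by move=> [/cluster_restrictW oh /cluster_restrictW]; exact: cluster_trans.
Qed.

Let tau (z : G) : \bar R := (connect_prob p oX z)%:E.

(** Each [z] is uniquely [iota h * u] with [pi u = 1], namely with [h = pi z], so the sum factors by
    [connect_prob_iota]. *)
Lemma esum_retract (a : R) : (0 < a)%R ->
    \esum_(u in [set u | pi u = 1]) tau u = a%:E ->
  \esum_(z in setT) tau z =
  (a%:E * \esum_(h in setT) (connect_prob p oY h)%:E)%E.
Proof.
move=> a0 aE.
have bij : set_bij (setT `*`` (fun _ : H => [set u | pi u = 1])) setT
    (fun k : H * G => iota k.1 * k.2).
  split=> //.
    move=> [h u] [h' u'] /set_mem[_ /= pu] /set_mem[_ /= pu'] /= e.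
    have hh : h = h'.
      by have := congr1 pi e; rewrite !piM pu pu' !mulg1.
    by move: e; rewrite hh => /mulgI ->.
  move=> z _; exists (pi z, iota (pi z)^-1 * z) => /=.
    by split=> //=; rewrite piM mulVg.
  by rewrite mulgA -iotaM mulgV iota1 mul1g.
rewrite (reindex_esum _ _ _ _ bij) -(esum_esum (a := fun h u => tau (iota h * u))).
  rewrite -esumZl ?(ltW a0) //; last by move=> h; rewrite lee_fin prob_ge0.
  apply: eq_esum => h _; rewrite muleC -aE -esumZl ?prob_ge0 //; last first.
    by move=> u; rewrite lee_fin prob_ge0.
  by apply: eq_esum => u pu; rewrite /tau connect_prob_iota.
by move=> h u _ _; rewrite lee_fin prob_ge0.
Qed.

End Retraction.

(** * Leading letters of normal forms *)

Section FreeProductHeads.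
Variables G1 G2 : groupType.
Local Open Scope group_scope.
Implicit Types (x y : G1 + G2) (v w : seq (G1 + G2)) (z : free_product G1 G2).

Definition headl z : G1 := if word_of z is inl g :: _ then g else 1.
Definition headr z : G2 := if word_of z is inr h :: _ then h else 1.

Lemma headl_inl_mul g z : headl (free_inl G2 g * z) = g * headl z.
Proof.
case: z => w rw; rewrite /headl /= /word1 /=.
have [->|g1] := eqVneq g 1; first by rewrite mul1g.
rewrite /mul_word /= /cons_letter /= (negbTE g1).
case: w rw => [|[k|k] w] rw; rewrite ?mulg1 //.
(* When the two letters cancel, the next letter, if any, belongs to the other factor, so the new
   head is 1. *)
case: ifP => // /eqP ->.
by case: w rw => [|[l|l] w] //; rewrite /reduced /= andbF.
Qed.

Lemma headr_inr_mul g z : headr (free_inr G1 g * z) = g * headr z.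
Proof.
case: z => w rw; rewrite /headr /= /word1 /=.
have [->|g1] := eqVneq g 1; first by rewrite mul1g.
rewrite /mul_word /= /cons_letter /= (negbTE g1).
case: w rw => [|[k|k] w] rw; rewrite ?mulg1 //.
case: ifP => // /eqP ->.
by case: w rw => [|[l|l] w] //; rewrite /reduced /= andbF.
Qed.

Lemma cons_letter_far x y v : ~~ trivial_letter x -> ~~ same_factor x y ->
  cons_letter x (y :: v) = x :: y :: v.
Proof.
by rewrite /cons_letter => /negbTE ->; case: x => g; case: y.
Qed.

Lemma mul_wordE x w v : mul_word (x :: w) v = cons_letter x (mul_word w v).
Proof. by []. Qed.

(** Only the last letter of the word can interact with a word [v] of at most one letter, and the
    alternation of factors stops any further cancellation. *)
Lemma mul_word_head x w v : reduced (x :: w) -> (size v <= 1)%N ->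
  mul_word (x :: w) v = [::] \/
  exists y u, mul_word (x :: w) v = y :: u /\ same_factor x y.
Proof.
elim: w x => [|y w ih] x rw v1.
  have nx : ~~ trivial_letter x by case/andP: rw => /= /andP[].
  case: v v1 => [|y [|//]] _ /=.
    rewrite /cons_letter (negbTE nx); right; exists x, [::].
    by case: x {rw nx}.
  rewrite /cons_letter (negbTE nx); case: x {rw nx} => g; case: y => h.
  - by case: ifP => _; [left|right; exists (inl (g * h)), [::]].
  - by right; exists (inl g), [:: inr h].
  - by right; exists (inr g), [:: inl h].
  - by case: ifP => _; [left|right; exists (inr (g * h)), [::]].
have nx : ~~ trivial_letter x by case/andP: rw => /= /andP[].
have xy : ~~ same_factor x y by case/andP: rw => _ /= /andP[].
right; have [e|[y' [u [e yy']]]] := ih y (reduced_behead rw) v1.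
  exists x, [::]; rewrite mul_wordE e.
  by rewrite /cons_letter (negbTE nx); case: (x).
exists x, (y' :: u); rewrite mul_wordE e.
rewrite cons_letter_far //; first by case: (x).
by case: (x) (y) (y') xy yy' => ? [?|?] [?|?].
Qed.

Lemma mul_word_far x y w v : reduced [:: x, y & w] -> (size v <= 1)%N ->
  exists u, mul_word [:: x, y & w] v = x :: u.
Proof.
move=> rw v1; have nx : ~~ trivial_letter x by case/andP: rw => /= /andP[].
have xy : ~~ same_factor x y by case/andP: rw => _ /= /andP[].
rewrite mul_wordE.
have [->|[y' [u [-> yy']]]] := mul_word_head (reduced_behead rw) v1.
  by exists [::]; rewrite /cons_letter (negbTE nx); case: (x).
exists (y' :: u); rewrite cons_letter_far //.
by case: (x) (y) (y') xy yy' => ? [?|?] [?|?].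
Qed.

Lemma size_word1 x : (size (word1 x) <= 1)%N.
Proof. by rewrite /word1; case: ifP. Qed.

Lemma free_inl_headl g z : word_of z = [:: inl g] -> z = free_inl G2 (headl z).
Proof.
move=> zg; apply: val_inj; rewrite /= /headl zg /word1 /=.
by move: (word_ofP z); rewrite zg /reduced /= !andbT => /negbTE ->.
Qed.

Lemma free_inr_headr g z : word_of z = [:: inr g] -> z = free_inr G1 (headr z).
Proof.
move=> zg; apply: val_inj; rewrite /= /headr zg /word1 /=.
by move: (word_ofP z); rewrite zg /reduced /= !andbT => /negbTE ->.
Qed.

(** The leading letter in [G1] can change only if the word is empty or a single letter of [G1], in
    which case [z] lies in the copy of [G1]. *)
Lemma headl_mul_inl z t : headl (z * free_inl G2 t) = headl z \/
  z = free_inl G2 (headl z).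
Proof.
case E: (word_of z) (word_ofP z) => [|[g|g] [|y w]] rw.
- by right; apply: val_inj; rewrite /= /headl E /word1 /= eqxx.
- by right; exact: free_inl_headl E.
- left; rewrite /headl /= E.
  by have [u ->] := mul_word_far rw (size_word1 (inl t)).
- left; rewrite /headl /= E.
  by have [->|[[h|h] [u [-> //]]]] := mul_word_head rw (size_word1 (inl t)).
- left; rewrite /headl /= E.
  by have [u ->] := mul_word_far rw (size_word1 (inl t)).
Qed.

Lemma headl_mul_inr z t : headl (z * free_inr G1 t) = headl z.
Proof.
case E: (word_of z) (word_ofP z) => [|[g|g] [|y w]] rw; rewrite /headl /= E.
- by rewrite /mul_word /word1; case: ifP.
- have g1 : (g == 1) = false.
    by apply/negbTE; move: rw; rewrite /reduced /= !andbT.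
  by rewrite /mul_word /word1 /= /cons_letter /= g1; case: ifP.
- by have [u ->] := mul_word_far rw (size_word1 (inr t)).
- by have [->|[[h|h] [u [-> //]]]] := mul_word_head rw (size_word1 (inr t)).
- by have [u ->] := mul_word_far rw (size_word1 (inr t)).
Qed.

Lemma headr_mul_inr z t : headr (z * free_inr G1 t) = headr z \/
  z = free_inr G1 (headr z).
Proof.
case E: (word_of z) (word_ofP z) => [|[g|g] [|y w]] rw.
- by right; apply: val_inj; rewrite /= /headr E /word1 /= eqxx.
- left; rewrite /headr /= E.
  by have [->|[[h|h] [u [-> //]]]] := mul_word_head rw (size_word1 (inr t)).
- left; rewrite /headr /= E.
  by have [u ->] := mul_word_far rw (size_word1 (inr t)).
- by right; exact: free_inr_headr E.
- left; rewrite /headr /= E.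
  by have [u ->] := mul_word_far rw (size_word1 (inr t)).
Qed.

Lemma headr_mul_inl z t : headr (z * free_inl G2 t) = headr z.
Proof.
case E: (word_of z) (word_ofP z) => [|[g|g] [|y w]] rw; rewrite /headr /= E.
- by rewrite /mul_word /word1; case: ifP.
- by have [->|[[h|h] [u [-> //]]]] := mul_word_head rw (size_word1 (inl t)).
- by have [u ->] := mul_word_far rw (size_word1 (inl t)).
- have g1 : (g == 1) = false.
    by apply/negbTE; move: rw; rewrite /reduced /= !andbT.
  by rewrite /mul_word /word1 /= /cons_letter /= g1; case: ifP.
- by have [u ->] := mul_word_far rw (size_word1 (inl t)).
Qed.

Lemma headl_headr z : headl z = 1 \/ headr z = 1.
Proof. by rewrite /headl /headr; case: (word_of z) => [|[g|g] w]; auto. Qed.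

Lemma headl1_headr1 z : headl z = 1 -> headr z = 1 -> z = 1.
Proof.
move=> hl hr; apply: val_inj => /=; move: hl hr (word_ofP z).
rewrite /headl /headr; case: (word_of z) => [|[g|g] w] //=.
  by move=> -> _; rewrite /reduced /= eqxx.
by move=> _ ->; rewrite /reduced /= eqxx.
Qed.

Variables (S1 : {fset G1}) (S2 : {fset G2}).

Lemma free_gensP s : reflect ((exists2 t, t \in S1 & s = free_inl G2 t) \/
    (exists2 t, t \in S2 & s = free_inr G1 t)) (s \in free_gens S1 S2).
Proof.
rewrite in_fsetU; apply: (iffP orP).
  by move=> [/imfsetP[t tS ->]|/imfsetP[t tS ->]]; [left|right]; exists t.
by move=> [[t tS ->]|[t tS ->]]; [left|right]; apply/imfsetP; exists t.
Qed.

Lemma free_gens_generate : generates S1 -> generates S2 ->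
  generates (free_gens S1 S2).
Proof.
move=> gen1 gen2 K closedK SK.
have [K1 KB] := closedK; have KM := group_closedM closedK.
have inlV g : free_inl G2 g^-1 = (free_inl G2 g)^-1.
  by apply: (@mulgI _ (free_inl G2 g)); rewrite -free_inlM !mulgV /free_inl;
    apply: val_inj; rewrite /= /word1 /= eqxx.
have inrV g : free_inr G1 g^-1 = (free_inr G1 g)^-1.
  by apply: (@mulgI _ (free_inr G1 g)); rewrite -free_inrM !mulgV /free_inr;
    apply: val_inj; rewrite /= /word1 /= eqxx.
have Kl g : free_inl G2 g \in K.
  apply: (gen1 [pred g | free_inl G2 g \in K]) => [|s sS]; last first.
    by apply: SK; apply/free_gensP; left; exists s.
  split=> [|x y]; rewrite !inE.
    by rewrite (_ : free_inl _ _ = 1) //; apply: val_inj; rewrite /= /word1 /= eqxx.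
  by rewrite free_inlM inlV; exact: KB.
have Kr g : free_inr G1 g \in K.
  apply: (gen2 [pred g | free_inr G1 g \in K]) => [|s sS]; last first.
    by apply: SK; apply/free_gensP; right; exists s.
  split=> [|x y]; rewrite !inE.
    by rewrite (_ : free_inr _ _ = 1) //; apply: val_inj; rewrite /= /word1 /= eqxx.
  by rewrite free_inrM inrV; exact: KB.
move=> [w rw]; elim: w rw => [|x w ih] rw.
  by rewrite (_ : FreeProduct _ = 1) //; exact: val_inj.
have nx : ~~ trivial_letter x by case/andP: rw => /= /andP[].
have Kw : FreeProduct (reduced_behead rw) \in K by exact: ih.
have xw := esym (cons_letter_reduced rw).
suff [y Ky ->] : exists2 y, y \in K &
    FreeProduct rw = y * FreeProduct (reduced_behead rw) by exact: KM.
case: x rw nx Kw xw => g rw nx _ xw; [exists (free_inl G2 g)|exists (free_inr G1 g)];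
  by [|apply: val_inj; rewrite /= /word1 (negbTE nx)].
Qed.

End FreeProductHeads.

(** * The renewal equations and the formula *)

Lemma renewal_identity (R : realFieldType) (x c1 c2 a1 a2 : R) :
  1 <= x -> x = a1 * c1 -> x = a2 * c2 -> a1 + a2 = x + 1 ->
  c1 + c2 - c1 * c2 != 0 /\ x = c1 * c2 / (c1 + c2 - c1 * c2).
Proof.
move=> x1 e1 e2 e; have x0 : x != 0 by rewrite gt_eqF // (lt_le_trans ltr01).
have [c10 c20] : c1 != 0 /\ c2 != 0.
  by split; [apply: contraNneq x0 => c0; rewrite e1 c0 mulr0|
             apply: contraNneq x0 => c0; rewrite e2 c0 mulr0].
(* Substitute x = a2 c2 in x c1, x = a1 c1 in x c2, and x = a1 + a2 - 1 in x c1 c2. *)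
have xD : x * (c1 + c2 - c1 * c2) = c1 * c2.
  rewrite mulrBr mulrDr {1}e2 {1}e1 (_ : x = a1 + a2 - 1); first by ring.
  by rewrite e addrK.
have D0 : c1 + c2 - c1 * c2 != 0.
  by apply: contraTneq (mulf_neq0 c10 c20) => D0; rewrite -xD D0 mulr0 eqxx.
by split=> //; apply: (canRL (mulfK D0)).
Qed.

(** Finiteness of both factors' mean sizes and nonvanishing of the denominator belong to the
    conclusion, so that neither [fine] nor the division takes a default value. *)
Theorem theorem2 (R : realType) (G1 G2 : groupType)
    (S1 : {fset G1}) (S2 : {fset G2})
    (genS1 : generates S1) (genS2 : generates S2) (p : {i01 R}) :
  let X1 := cayley_graph S1 in
  let X2 := cayley_graph S2 in
  let X := cayley_graph (free_gens S1 S2) in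
  let chi1 := mean_cluster_size (1%g : vertex X1) p in
  let chi2 := mean_cluster_size (1%g : vertex X2) p in
  p%:num < critical_probability R (1%g : vertex X) ->
  let D := fine chi1 + fine chi2 - fine chi1 * fine chi2 in
  [/\ chi1 \is a fin_num, chi2 \is a fin_num, D != 0 &
      mean_cluster_size (1%g : vertex X) p = (fine chi1 * fine chi2 / D)%:E].
Proof.
move=> X1 X2 X chi1 chi2 ppc.
have genS := free_gens_generate genS1 genS2.
pose tau z : \bar R := (connect_prob p (1%g : vertex X) z)%:E.
have tau0 z : (0 <= tau z)%E by rewrite lee_fin connect_prob_ge0.
have tau1 : tau 1%g = 1%E by rewrite /tau connect_probxx.
have chiE : mean_cluster_size (1%g : vertex X) p = (\esum_(z in [set: vertex X]) tau z)%E.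
  exact: (mean_cluster_sizeE _ _ (edge_ball_exhausting genS) (word_ball_exhausting genS)).
have chi1E : chi1 = (\esum_(z in [set: vertex X1]) (connect_prob p (1%g : vertex X1) z)%:E)%E.
  exact: (mean_cluster_sizeE _ _ (edge_ball_exhausting genS1) (word_ball_exhausting genS1)).
have chi2E : chi2 = (\esum_(z in [set: vertex X2]) (connect_prob p (1%g : vertex X2) z)%:E)%E.
  exact: (mean_cluster_sizeE _ _ (edge_ball_exhausting genS2) (word_ball_exhausting genS2)).
set chi := (\esum_(z in _) tau z)%E in chiE.
pose U1 : set (vertex X) := [set z | headl z = 1%g].
pose U2 : set (vertex X) := [set z | headr z = 1%g].
have [K chiK] := subcritical_bound genS ppc.
have chi_fin : chi \is a fin_num.
  rewrite ge0_fin_numE; last by apply: esum_ge0.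
  apply: (@le_lt_trans _ _ K%:E); last exact: ltry.
  apply: esum_le_seq => // r ur; rewrite sumEFin lee_fin; exact: chiK.
(* The sum over a set containing the origin is at least 1, from the origin alone, and at most
   [chi]. *)
have part (U : set (vertex X)) : U 1%g ->
    exists2 a : R, 1 <= a & (\esum_(z in U) tau z)%E = a%:E.
  move=> U1g; have Uge : (1 <= \esum_(z in U) tau z)%E.
    rewrite -tau1 -(@esum_set1 _ _ 1%g tau) //.
    rewrite (esum_mkcond [set _]) (esum_mkcond U).
    apply: le_esum => z _; case: ifPn => [/set_mem ->|_]; last by case: ifP.
    by rewrite mem_set.
  have Ule : (\esum_(z in U) tau z <= chi)%E.
    rewrite /chi (esum_mkcond U); apply: le_esum => z _.
    by case: ifP.
  have Ufin : (\esum_(z in U) tau z)%E \is a fin_num.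
    rewrite ge0_fin_numE; last by apply: esum_ge0.
    by apply: le_lt_trans Ule _; rewrite ltey_eq chi_fin.
  by exists (fine (\esum_(z in U) tau z)%E); rewrite -?lee_fin fineK.
have [a1 a1_ge1 a1E] : exists2 a : R, 1 <= a & (\esum_(z in U1) tau z)%E = a%:E by exact: part.
have [a2 a2_ge1 a2E] : exists2 a : R, 1 <= a & (\esum_(z in U2) tau z)%E = a%:E by exact: part.
have [x x1 xE] : exists2 x : R, 1 <= x & chi = x%:E by exact: part.
have chi_a1 : chi = (a1%:E * chi1)%E.
  rewrite chi1E; apply: (@esum_retract R p _ _ (free_gens S1 S2) S1
    (@free_inl G1 G2) (@headl G1 G2)) => //.
  - exact: free_inlM.
  - exact: headl_inl_mul.
  - by move=> t tS; apply/free_gensP; left; exists t.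
  - move=> z s /free_gensP[[t tS ->]|[t tS ->]].
      have [|zE] := headl_mul_inl z t; [by left|right].
      by split=> //; exists t.
    by left; exact: headl_mul_inr.
  - exact: lt_le_trans a1_ge1.
have chi_a2 : chi = (a2%:E * chi2)%E.
  rewrite chi2E; apply: (@esum_retract R p _ _ (free_gens S1 S2) S2
    (@free_inr G1 G2) (@headr G1 G2)) => //.
  - exact: free_inrM.
  - exact: headr_inr_mul.
  - by move=> t tS; apply/free_gensP; right; exists t.
  - move=> z s /free_gensP[[t tS ->]|[t tS ->]].
      by left; exact: headr_mul_inl.
    have [|zE] := headr_mul_inr z t; [by left|right].
    by split=> //; exists t.
  - exact: lt_le_trans a2_ge1.
(* Every element has trivial head in at least one factor, and only the identity in both; the
   identity is therefore counted twice and contributes the extra 1. *)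
have aa : a1 + a2 = x + 1.
  apply: EFin_inj; rewrite !EFinD -a1E -a2E -xE -tau1.
  rewrite /chi [in RHS](esumID U1) // [in LHS](esumID U1 U2) //.
  have -> : U2 `&` U1 = [set 1%g].
    rewrite eqEsubset; split => z /=; last by move=> ->.
    by move=> [? ?]; exact: headl1_headr1.
  have -> : U2 `&` ~` U1 = [set: vertex X] `&` ~` U1.
    rewrite eqEsubset; split => z /= [_ zU1]; split=> //.
    by have [] := headl_headr z.
  by rewrite esum_set1 // !setTI addeA addeAC.
(* An infinite [c] times a positive [a] would make [chi] infinite. *)
have fin_factor (a : R) (c : \bar R) : 1 <= a -> (0 <= c)%E ->
    chi = (a%:E * c)%E -> c \is a fin_num.
  move=> a1' c0 chic; have a0 : 0 < a by exact: lt_le_trans a1'.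
  rewrite ge0_fin_numE // ltey; apply/eqP => coo.
  by move: chi_fin; rewrite chic coo gt0_muley ?lte_fin.
have chi1_ge0 : (0 <= chi1)%E.
  by rewrite chi1E; apply: esum_ge0 => z _; rewrite lee_fin connect_prob_ge0.
have chi2_ge0 : (0 <= chi2)%E.
  by rewrite chi2E; apply: esum_ge0 => z _; rewrite lee_fin connect_prob_ge0.
have fin1 := fin_factor _ _ a1_ge1 chi1_ge0 chi_a1.
have fin2 := fin_factor _ _ a2_ge1 chi2_ge0 chi_a2.
have [||D0 xD] := @renewal_identity R x (fine chi1) (fine chi2) a1 a2 x1 _ _ aa.
- by apply: EFin_inj; rewrite EFinM fineK // -xE.
- by apply: EFin_inj; rewrite EFinM fineK // -xE.
by split=> //; rewrite chiE xE xD.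
Qed.
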